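(* Let $(A,\mathfrak m)$ be a Cohen-Macaulay (Noetherian) local ring of dimension $d\le 1$ with infinite residue field, and let $I$ be an $\mathfrak m$-primary integrally closed ideal of $A$. If $e_2(I)=e_1(I)-e_0(I)+\lambda(A/I)+1$, then the following hold: (i) $\deg h_I(t)=3$. (ii) If $d=1$ and $J=(x)$ is a minimal reduction of $I$ with $I^3\nsubseteq J$, then $G(I)$ is Cohen-Macaulay.
   Context: $\lambda(-)$ denotes length. For an $\mathfrak m$-primary ideal $I$ of a $d$-dimensional Noetherian local ring $(A,\mathfrak m)$, the Hilbert series is $\sum_{n\ge 0}\lambda(I^n/I^{n+1})t^n=\dfrac{h_I(t)}{(1-t)^d}$ with $h_I(t)\in\mathbb Z[t]$, $h_I(1)\ne 0$; $h_I(t)$ is the $h$-polynomial of $I$. The Hilbert coefficients are defined for all $i\ge 0$ (including $i>d$) by $e_i(I)=h_I^{(i)}(1)/i!$, where $h_I^{(i)}$ is the $i$-th formal derivative. $G(I)=\bigoplus_{n\ge 0}I^n/I^{n+1}$ is the associated graded ring of $I$. An ideal $J\subseteq I$ is a reduction of $I$ if $JI^n=I^{n+1}$ for some $n$; a minimal reduction is a reduction that is minimal with respect to inclusion. *)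

(* Defs.v *)
From HB Require Import structures.
From mathcomp Require Import all_boot all_order all_algebra.
From mathcomp Require Import boolp classical_sets.

Set Implicit Arguments.
Unset Strict Implicit.
Unset Printing Implicit Defensive.

Import GRing.Theory.
Local Open Scope ring_scope.
Local Open Scope classical_set_scope.

Definition is_max (E : set nat) (n : nat) : Prop :=
  E n /\ forall k, E k -> (k <= n)%N.

Section Ideals.
Variable R : comNzRingType.
Implicit Types (I J K M P Q S : set R) (s : seq R) (n d : nat).

(* Not necessarily proper, unlike the structure [idealr]. *)
Definition ideal J : Prop :=
  [/\ J 0, forall a b, J a -> J b -> J (a + b) & forall r a, J a -> J (r * a)].

Definition gen_ideal S : set R := smallest ideal S.

Definition ideal_mul I J : set R :=
  gen_ideal [set x | exists a b, [/\ I a, J b & x = a * b]].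

Definition ideal_exp I n : set R := iter n (ideal_mul I) setT.

Definition noetherian : Prop :=
  forall J, ideal J -> exists s, J = gen_ideal [set` s].

Definition prime_ideal P : Prop :=
  [/\ ideal P, ~ P 1 & forall a b, P (a * b) -> P a \/ P b].

Definition maximal_ideal M : Prop :=
  [/\ ideal M, ~ M 1 & forall J, ideal J -> M `<=` J -> J = M \/ J = setT].

Definition local_ring M : Prop := forall J, maximal_ideal J <-> J = M.

Definition radical J : set R := [set x | exists n, J (x ^+ n)].

Definition primary_ideal Q : Prop :=
  [/\ ideal Q, ~ Q 1 & forall a b, Q (a * b) -> Q a \/ radical Q b].

Definition primary_to M Q : Prop := primary_ideal Q /\ radical Q = M.

Definition prime_chain n (P : nat -> set R) : Prop :=
  (forall i, (i <= n)%N -> prime_ideal (P i)) /\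
  (forall i, (i < n)%N -> P i `<` P i.+1).

Definition krull_dim d : Prop := is_max [set n | exists P : nat -> set R, prime_chain n P] d.

Definition height P d : Prop :=
  is_max [set n | exists Q : nat -> set R, prime_chain n Q /\ Q n = P] d.

Definition regular_seq s : Prop :=
  ~ gen_ideal [set` s] 1 /\
  forall i, (i < size s)%N -> forall a,
    gen_ideal [set` take i s] (s`_i * a) -> gen_ideal [set` take i s] a.

Definition depth J d : Prop :=
  is_max [set n | exists s, [/\ size s = n, regular_seq s & [set` s] `<=` J]] d.

(* For a local ring, this says depth = dimension.  In general, the depth of a
   maximal ideal M on R is the depth of the localization R_M, and the height
   of M is the dimension of R_M. *)
Definition cohen_macaulay : Prop :=
  noetherian /\
  forall M, maximal_ideal M -> exists n, depth M n /\ height M n.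

(* Length of the R-module K/J, for ideals J included in K: its submodules are
   the ideals between J and K. *)
Definition ideal_chain J K n (C : nat -> set R) : Prop :=
  [/\ C 0%N = J, C n = K, forall i, (i <= n)%N -> ideal (C i) &
      forall i, (i < n)%N -> C i `<` C i.+1].

Definition has_length K J n : Prop :=
  is_max [set k | exists C, ideal_chain J K k C] n.

(* Junk value 0 when the length is infinite. *)
Definition quotient_length K J : nat := xget 0%N (has_length K J).

Definition integral_over I (x : R) : Prop :=
  exists n (a : nat -> R), [/\ (0 < n)%N,
    forall i, (1 <= i <= n)%N -> ideal_exp I i (a i) &
    x ^+ n + \sum_(1 <= i < n.+1) a i * x ^+ (n - i) = 0].

Definition integrally_closed I : Prop := forall x, integral_over I x -> I x.

Definition reduction I J : Prop :=
  [/\ ideal J, J `<=` I &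
      exists n, ideal_mul J (ideal_exp I n) = ideal_exp I n.+1].

Definition minimal_reduction I J : Prop :=
  reduction I J /\ forall K, reduction I K -> K `<=` J -> K = J.

Definition hilbert_fun I n : nat := quotient_length (ideal_exp I n) (ideal_exp I n.+1).

(* h is the product of (1 - t)^d with the power series of the hilbert_fun I n,
   compared coefficientwise. *)
Definition h_polynomial I d (h : {poly int}) : Prop :=
  h.[1] != 0 /\
  forall n, h`_n =
    \sum_(k < n.+1) ((1 - 'X) ^+ d : {poly int})`_k * (hilbert_fun I (n - k))%:Z.

Lemma ideal_setT : ideal setT.
Proof. by []. Qed.

Lemma gen_idealP S : ideal (gen_ideal S).
Proof.
split=> [J [[]] //|a b Sa Sb J SJ|r a Sa J SJ].
  by case: (SJ) => -[_ JD _] _; apply: JD; [apply: Sa|apply: Sb].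
by case: (SJ) => -[_ _ JM] _; apply: JM; apply: Sa.
Qed.

Lemma ideal_expP I n : ideal (ideal_exp I n).
Proof. by case: n => [|n]; [exact: ideal_setT|exact: gen_idealP]. Qed.

Lemma ideal_mul_mem I J a b : I a -> J b -> ideal_mul I J (a * b).
Proof. by move=> Ia Jb K [_]; apply; exists a, b. Qed.

Lemma ideal_exp_mem I i j a b :
  ideal_exp I i a -> ideal_exp I j b -> ideal_exp I (i + j) (a * b).
Proof.
elim: i a => [|i IHi] a Ia Jb.
  by case: (ideal_expP I j) => _ _; apply.
have [E0 ED EM] := ideal_expP I (i.+1 + j).
have := Ia [set c | ideal_exp I (i.+1 + j) (c * b)]; apply; split.
  split=> /= [|c c'|r c]; rewrite ?mul0r ?mulrDl -?mulrA //.
  - exact: ED.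
  - exact: EM.
by move=> _ [u [v [Iu Iv ->]]] /=; rewrite -mulrA; apply: ideal_mul_mem (IHi v Iv Jb).
Qed.

Lemma ideal_expS_sub I n : ideal_exp I n.+1 `<=` ideal_exp I n.
Proof.
move=> x; apply; split; first exact: ideal_expP.
move=> _ [a [b [_ Ib ->]]].
by have [_ _] := ideal_expP I n; apply.
Qed.

Lemma ideal_exp1_sub I : ideal I -> ideal_exp I 1 `<=` I.
Proof.
move=> II x; apply; split=> // _ [a [b [Ia _ ->]]].
by rewrite mulrC; case: II => _ _; apply.
Qed.

Lemma ideal_sum J n (F : 'I_n -> R) :
  ideal J -> (forall i, J (F i)) -> J (\sum_i F i).
Proof. by move=> [J0 JD _] JF; apply: big_ind. Qed.

Lemma ideal_sub J a b : ideal J -> J a -> J b -> J (a - b).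
Proof. by move=> [_ JD JM] Ja Jb; apply: JD => //; rewrite -mulN1r; apply: JM. Qed.

Lemma idealr_ideal (I : idealr R) : ideal [set` I].
Proof.
by split=> /= [|a b|r a]; [exact: rpred0|exact: rpredD|exact: idealMr].
Qed.

(* The Rees algebra of I: the polynomials whose n-th coefficient is in I^n. *)
Definition rees (I : idealr R) : {pred {poly R}} :=
  fun p => `[< forall n, ideal_exp [set` I] n p`_n >].

Lemma rees_subring (I : idealr R) : subring_closed (rees I).
Proof.
split=> [|p q|p q]; rewrite /in_mem /=.
- apply/asboolP=> n; rewrite coef1; case: n => [|n] //=.
  by case: (ideal_expP [set` I] n.+1).
- move=> /asboolP Ip /asboolP Iq; apply/asboolP=> n; rewrite coefB.
  exact: ideal_sub (ideal_expP _ _) (Ip n) (Iq n).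
- move=> /asboolP Ip /asboolP Iq; apply/asboolP=> n; rewrite coefM.
  apply: ideal_sum (ideal_expP _ _) _ => i.
  by rewrite -{1}(subnKC (ltn_ord i : (i <= n)%N)); apply: ideal_exp_mem.
Qed.

HB.instance Definition _ (I : idealr R) :=
  GRing.isSubringClosed.Build {poly R} (rees I) (rees_subring I).

Record rees_algebra (I : idealr R) :=
  ReesElement { rees_val :> {poly R}; rees_valP : rees_val \in rees I }.

HB.instance Definition _ (I : idealr R) := [isSub for @rees_val I].
HB.instance Definition _ (I : idealr R) := [Choice of rees_algebra I by <:].
HB.instance Definition _ (I : idealr R) :=
  [SubChoice_isSubComNzRing of rees_algebra I by <:].

Definition gr_kernel (I : idealr R) : pred (rees_algebra I) :=
  fun p => `[< forall n, ideal_exp [set` I] n.+1 (rees_val p)`_n >].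

Lemma gr_kernel_idealr (I : idealr R) : idealr_closed (@gr_kernel I).
Proof.
split=> [||p q r]; rewrite /in_mem /=.
- apply/asboolP=> n; rewrite coef0.
  by case: (ideal_expP [set` I] n.+1).
- apply/asboolP=> /(_ 0%N); rewrite coef1 /=.
  by move/(ideal_exp1_sub (idealr_ideal I)); rewrite /= idealr1.
- move=> /asboolP Iq /asboolP Ir; apply/asboolP=> n; rewrite coefD coefM.
  have [_ ED _] := ideal_expP [set` I] n.+1.
  apply: ED => //; apply: ideal_sum (ideal_expP _ _) _ => i.
  rewrite -{1}(subnKC (ltn_ord i : (i <= n)%N)) -addnS.
  by apply: ideal_exp_mem => //; case: p => p /= /asboolP.
Qed.

HB.instance Definition _ (I : idealr R) :=
  isIdealr.Build (rees_algebra I) (@gr_kernel I) (gr_kernel_idealr I).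

(* A polynomial \sum_n a_n t^n with a_n in I^n, taken modulo those with a_n in
   I^(n+1), is an element of the direct sum of the I^n/I^(n+1); products of
   polynomials induce the product of the associated graded ring. *)
Definition assoc_graded (I : idealr R) : comNzRingType :=
  {ideal_quot (@gr_kernel I : idealr _)}.

End Ideals.

(* e_i = h^(i)(1) / i!, computed in the integers: h^`N(i) is h^(i) / i!. *)
Definition hilbert_coef (h : {poly int}) (i : nat) : int := h^`N(i).[1].

Arguments noetherian R : clear implicits.
Arguments krull_dim R d : clear implicits.
Arguments cohen_macaulay R : clear implicits.

(* Main.v *)
(* In dimension 0, h_n = lambda(I^n/I^(n+1)) and the hypothesis reads
   \sum_(n >= 3) C(n-1, 2) h_n = 1, whence h_3 = 1 and h_n = 0 for n > 3.
   In dimension 1, let (x) be a reduction of I and v_n = lambda(I^(n+1)/x I^n).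
   Since lambda(I^n/I^(n+1)) = e_0 - v_n, the same identity becomes
   \sum_(n >= 2) (n-1) v_n = 1, so v_2 = 1 and v_n = 0 for n > 2; thus deg h = 3.
   The reduction x is obtained from generators of I by replacing two of them,
   u and v, with u + c v: if this failed for N residue classes of c, products of
   the u + c_i v would give chains of length N in I^n/I^(n+1) for n large, but
   these lengths are bounded because h is a polynomial.

   For (ii), I^(n+1) n (x) = x I^n for all n: for n = 1 because a/x is integral
   over A when x a is in I^2, so that a is integral over I; for n = 2 because
   v_2 = 1 and x I^2 <= I^3 n (x) < I^3; for n > 2 because v_n = 0.  Hence the
   class T of x in I/I^2 is regular on G(I).  As G(I) is filtered by degree with
   quotients of bounded length over A, a quotient of G(I) by an element that is
   regular modulo an ideal has finite length, which bounds dimension and depth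
   by 1, and every maximal ideal contains T or a monic polynomial in T, both
   of which are regular. *)

Require Import Defs.
From HB Require Import structures.
From mathcomp Require Import all_boot all_order all_algebra.
From mathcomp Require Import boolp classical_sets functions cardinality.
From mathcomp Require Import ring zify.

Set Implicit Arguments.
Unset Strict Implicit.
Unset Printing Implicit Defensive.

Import GRing.Theory.
Local Open Scope ring_scope.
Local Open Scope classical_set_scope.

(** * Lengths of subquotients *)

Lemma is_max_exists (E : set nat) (n0 N : nat) :
  E n0 -> (forall k, E k -> (k <= N)%N) -> exists n, is_max E n.
Proof.
move=> En0 leN.
have exE : exists k, `[< E k >] by exists n0; apply/asboolP.
have ubE k : `[< E k >] -> (k <= N)%N by move/asboolP/leN.
exists (ex_maxn exE ubE); case: ex_maxnP => n /asboolP En maxn.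
by split=> // k Ek; apply: maxn; apply/asboolP.
Qed.

Section Length.
Variables (A B : comNzRingType) (phi : {rmorphism A -> B}).
Implicit Types (S J K L : set B) (C : nat -> set B).

(* B is viewed as an A-module through phi; for phi the identity of A these are
   the ideals of A. *)
Definition submod S : Prop :=
  [/\ S 0, forall u v, S u -> S v -> S (u + v) & forall a u, S u -> S (phi a * u)].

(* The ends of the chain need not be J and K. *)
Definition chain K J k : Prop :=
  exists2 C, forall i, (i <= k)%N -> [/\ submod (C i), J `<=` C i & C i `<=` K]
           & forall i, (i < k)%N -> C i `<` C i.+1.

Definition lenle K J n : Prop := forall k, chain K J k -> (k <= n)%N.

Definition flen K J : Prop := exists n, lenle K J n.

(** As with [quotient_length], unbounded chains give the default 0, so additivity is stated under
    [flen]. *)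
Definition mlen K J : nat := xget 0%N (is_max [set k | chain K J k]).

Lemma submodB S u v : submod S -> S u -> S v -> S (u - v).
Proof.
move=> [_ SD SM] Su Sv; apply: SD => //.
by rewrite -mulN1r -(rmorph1 phi) -rmorphN; apply: SM.
Qed.

Lemma submod_sum S n (f : 'I_n -> B) :
  submod S -> (forall i, S (f i)) -> S (\sum_i f i).
Proof. by move=> [S0 SD SM] Sf; apply: big_ind. Qed.

Definition sumset J K : set B := [set w | exists u v, [/\ J u, K v & w = u + v]].

Lemma submodI J K : submod J -> submod K -> submod (J `&` K).
Proof.
move=> [J0 JD JM] [K0 KD KM]; split=> // [u v [Ju Ku] [Jv Kv]|a u [Ju Ku]]; split; auto.
Qed.

Lemma submod_sumset J K : submod J -> submod K -> submod (sumset J K).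
Proof.
move=> [J0 JD JM] [K0 KD KM]; split.
- by exists 0, 0; rewrite addr0.
- move=> _ _ [u [v [Ju Kv ->]]] [u' [v' [Ju' Kv' ->]]].
  by exists (u + u'), (v + v'); rewrite addrACA; split; auto.
- by move=> a _ [u [v [Ju Kv ->]]]; exists (phi a * u), (phi a * v); rewrite mulrDr; split; auto.
Qed.

Lemma sumsetl J K : submod K -> J `<=` sumset J K.
Proof. by move=> [K0 _ _] u Ju; exists u, 0; rewrite addr0. Qed.

Lemma sumsetr J K : submod J -> K `<=` sumset J K.
Proof. by move=> [J0 _ _] u Ku; exists 0, u; rewrite add0r. Qed.

Lemma sumset_sub J K L : submod L -> J `<=` L -> K `<=` L -> sumset J K `<=` L.
Proof. by move=> [_ LD _] JL KL _ [u [v [/JL Ju /KL Kv ->]]]; apply: LD. Qed.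

Lemma chain_sub K J K' J' k : J `<=` J' -> K' `<=` K -> chain K' J' k -> chain K J k.
Proof.
move=> JJ' KK' [C Cb Cs]; exists C => // i ik.
by have [? JC CK] := Cb i ik; split=> //; [apply: subset_trans JC|apply: subset_trans KK'].
Qed.

Lemma lenle_sub K J K' J' n : J `<=` J' -> K' `<=` K -> lenle K J n -> lenle K' J' n.
Proof. by move=> JJ' KK' len k /(chain_sub JJ' KK')/len. Qed.

Lemma flen_sub K J K' J' : J `<=` J' -> K' `<=` K -> flen K J -> flen K' J'.
Proof. by move=> JJ' KK' [n len]; exists n; apply: lenle_sub len. Qed.

Lemma lenleW K J m n : (m <= n)%N -> lenle K J m -> lenle K J n.
Proof. by move=> mn len k /len km; apply: leq_trans mn. Qed.

Lemma chain0 K J : submod J -> J `<=` K -> chain K J 0.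
Proof. by move=> sJ JK; exists (fun=> J) => // i _; split. Qed.

Lemma chain_ext K J K' k : chain K J k -> J `<=` K -> submod K' -> K `<` K' ->
  chain K' J k.+1.
Proof.
move=> [C Cb Cs] JK sK' [KK' nK'K].
exists (fun i => if (i <= k)%N then C i else K') => i ik.
  case: ifP => [le_ik|_]; last by split=> //; apply: subset_trans KK'.
  by have [? ? CK] := Cb i le_ik; split=> //; apply: subset_trans KK'.
rewrite -ltnS ik; have [lt_ik|le_ki] := ltnP i k; first exact: Cs.
have -> : i = k by apply/eqP; rewrite eqn_leq le_ki -ltnS ik.
have [_ _ CK] := Cb k (leqnn k); split; first exact: subset_trans KK'.
by move=> K'C; apply: nK'K; apply: subset_trans CK.
Qed.

Lemma chain1 K J : submod J -> submod K -> J `<` K -> chain K J 1.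
Proof. by move=> sJ sK JK; apply: (chain_ext (K := J)) => //; apply: chain0. Qed.

Lemma lenle0 K J : submod J -> submod K -> J `<=` K -> lenle K J 0 -> K `<=` J.
Proof.
by move=> sJ sK JK len; apply: contrapT => nKJ; have := len 1%N (chain1 sJ sK (conj JK nKJ)).
Qed.

Lemma chain_cat L K J a b : chain K J a -> chain L K b -> J `<=` K -> K `<=` L ->
  chain L J (a + b).
Proof.
move=> [C Cb Cs] [D Db Ds] JK KL.
(* [D 0] is dropped, as it may equal [C a]; the step from [C a] to [D 1] is strict because [C a]
   lies in [K] and [K] in [D 0]. *)
exists (fun i => if (i <= a)%N then C i else D (i - a)%N) => i ik.
  case: ifP => [/Cb[? JC CK]|/negbT]; first by split=> //; apply: subset_trans KL.
  rewrite -ltnNge => ai; have := Db (i - a)%N; rewrite leq_subLR => /(_ ik)[? KD DL].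
  by split=> //; apply: subset_trans KD.
have [lt_ia|le_ai] := ltnP i a; first by rewrite ltnW //; apply: Cs.
have := Ds (i - a)%N; rewrite ltn_subLR // => /(_ ik); rewrite subSn //.
case: ifP => // ia; have -> : i = a by apply/eqP; rewrite eqn_leq ia.
rewrite subnn => -[DD nDD]; have [_ _ CK] := Cb a (leqnn a).
have [_ KD _] := Db 0%N (leq0n b).
have CD := subset_trans CK KD.
by split=> [|DC]; [apply: subset_trans DD|apply: nDD; apply: subset_trans CD].
Qed.

Lemma lenle_step K J J1 n : submod J -> submod J1 -> J `<` J1 -> J1 `<=` K ->
  lenle K J n.+1 -> lenle K J1 n.
Proof.
move=> sJ sJ1 JJ1 J1K len k ch; rewrite -ltnS; apply: len.
by apply: (chain_cat (K := J1) (a := 1)) => //; [apply: chain1|case: JJ1].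
Qed.

(* Modular law: if C < C', then C n K < C' n K or C + K < C' + K. *)
Lemma chain_split L K J k : submod J -> submod K -> submod L ->
    J `<=` K -> K `<=` L -> chain L J k ->
  exists i j, [/\ (k <= i + j)%N, chain K J i & chain L K j].
Proof.
move=> sJ sK sL JK KL [C Cb Cs].
suff: forall l, (l <= k)%N -> exists i j, [/\ (l <= i + j)%N,
    chain (C l `&` K) J i & chain (sumset (C l) K) K j].
  move=> /(_ k (leqnn k))[i [j [ij ch1 ch2]]]; exists i, j; split=> //.
    by apply: chain_sub ch1 => // ? [].
  have [_ _ CL] := Cb k (leqnn k).
  by apply: chain_sub ch2 => //; apply: sumset_sub.
elim=> [|l IHl] lk.
  have [sC JC CL] := Cb 0%N (leq0n k).
  exists 0%N, 0%N; split=> //; apply: chain0 => //; last exact: sumsetr.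
  by move=> u Ju; split; [apply: JC|apply: JK].
have [sC JC CL] := Cb l (ltnW lk); have [sC' JC' CL'] := Cb l.+1 lk.
have [i [j [ij ch1 ch2]]] := IHl (ltnW lk).
have [CC nCC] := Cs l lk.
have CCI : C l `&` K `<=` C l.+1 `&` K by move=> u [/CC ? ?].
have CCD : sumset (C l) K `<=` sumset (C l.+1) K.
  by move=> _ [u [v [/CC Cu Kv ->]]]; exists u, v.
have [CI|nCI] := pselect (C l.+1 `&` K `<=` C l `&` K); last first.
  exists i.+1, j; split; first by rewrite addSn.
    apply: (chain_ext ch1) => //; last exact: submodI.
    by move=> u Ju; split; [apply: JC|apply: JK].
  by apply: chain_sub ch2.
exists i, j.+1; split; first by rewrite addnS.
  exact: chain_sub ch1.
apply: (chain_ext ch2); [exact: sumsetr|exact: submod_sumset|split=> // CD].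
(* The component [v] of [u] in [K] lies in [C l.+1], hence in [C l] because the intersections with
   [K] agree. *)
apply: nCC => u C'u; have [u' [v [Cu' Kv uE]]] := CD u (sumsetl sK C'u).
have Cv : C l v.
  apply: (proj1 (CI v _)); split=> //.
  have -> : v = u - u' by rewrite uE addrC addKr.
  by apply: submodB => //; apply: CC.
by rewrite uE; case: sC => _ CD' _; apply: CD'.
Qed.

Lemma lenle_add L K J a b : submod J -> submod K -> submod L ->
  J `<=` K -> K `<=` L -> lenle K J a -> lenle L K b -> lenle L J (a + b).
Proof.
move=> sJ sK sL JK KL lena lenb k /(chain_split sJ sK sL JK KL)[i [j [kij chi chj]]].
by apply: leq_trans kij (leq_add _ _); [apply: lena|apply: lenb].
Qed.

Lemma flen_add L K J : submod J -> submod K -> submod L ->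
  J `<=` K -> K `<=` L -> flen K J -> flen L K -> flen L J.
Proof.
by move=> sJ sK sL JK KL [a lena] [b lenb]; exists (a + b)%N; apply: (lenle_add (K := K)).
Qed.

Lemma mlen_max K J : submod J -> J `<=` K -> flen K J ->
  is_max [set k | chain K J k] (mlen K J).
Proof.
move=> sJ JK [n len]; apply: xgetPex.
by apply: (is_max_exists (n0 := 0%N) (N := n)) => //; apply: chain0.
Qed.

Lemma lenle_mlen K J : submod J -> J `<=` K -> flen K J -> lenle K J (mlen K J).
Proof. by move=> sJ JK fl; have [_ ub] := mlen_max sJ JK fl. Qed.

Lemma chain_mlen K J : submod J -> J `<=` K -> flen K J -> chain K J (mlen K J).
Proof. by move=> sJ JK fl; have [ch _] := mlen_max sJ JK fl. Qed.

Lemma mlen_le K J n : submod J -> J `<=` K -> lenle K J n -> (mlen K J <= n)%N.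
Proof. by move=> sJ JK len; apply/len/chain_mlen => //; exists n. Qed.

Lemma mlen_add L K J : submod J -> submod K -> submod L ->
  J `<=` K -> K `<=` L -> flen L J -> mlen L J = (mlen K J + mlen L K)%N.
Proof.
move=> sJ sK sL JK KL fl; have JL := subset_trans JK KL.
have flK : flen K J by apply: flen_sub fl.
have flL : flen L K by apply: flen_sub fl.
apply/eqP; rewrite eqn_leq; apply/andP; split.
  by apply: mlen_le => //; apply: (lenle_add (K := K)) => //; apply: lenle_mlen.
apply: (lenle_mlen sJ JL fl).
by apply: (chain_cat (K := K)) => //; apply: chain_mlen.
Qed.

Lemma mlen_eq0 K J : submod J -> submod K -> J `<=` K -> flen K J ->
  mlen K J = 0%N -> K `<=` J.
Proof. by move=> sJ sK JK fl K0; apply: lenle0 => //; rewrite -K0; apply: lenle_mlen. Qed.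

Lemma lenlexx K : lenle K K 0.
Proof.
move=> k [C Cb Cs]; rewrite leqNgt; apply/negP => k0.
have [_ nCC] := Cs 0%N k0; apply: nCC.
have [_ _ C1K] := Cb 1%N k0; have [_ KC _] := Cb 0%N (leq0n k).
exact: subset_trans KC.
Qed.

Lemma mlenxx K : submod K -> mlen K K = 0%N.
Proof. by move=> sK; apply/eqP; rewrite -leqn0; apply: mlen_le => //; apply: lenlexx. Qed.

(** By additivity [K / K'] has length 0. *)
Lemma mlen_supK K K' J : submod J -> submod K' -> submod K -> J `<=` K' -> K' `<=` K ->
  flen K J -> (mlen K J <= mlen K' J)%N -> K `<=` K'.
Proof.
move=> sJ sK' sK JK' K'K fl; rewrite (mlen_add sJ sK' sK) // => le.
have flK : flen K K' by apply: flen_sub fl.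
by apply: mlen_eq0 => //; apply/eqP; rewrite -leqn0; rewrite -(leq_add2l (mlen K' J)) addn0.
Qed.

(** Otherwise the sequence, read backwards from index [n.+1], would be a chain longer than the
    bound. *)
Lemma flen_desc K J (D : nat -> set B) : flen K J ->
    (forall i, [/\ submod (D i), J `<=` D i & D i `<=` K]) ->
    (forall i, D i.+1 `<=` D i) ->
  exists i, D i `<=` D i.+1.
Proof.
move=> [n len] Db DS; apply: contrapT => nD.
suff /len : chain K J n.+1 by rewrite ltnn.
exists (fun i => D (n.+1 - i)%N) => i lei; first exact: Db.
rewrite subSS (subSn (lei : (i <= n)%N)); split; first exact: DS.
by move=> DD; apply: nD; exists (n - i)%N.
Qed.

Lemma flen_asc K J (D : nat -> set B) : flen K J ->
    (forall i, [/\ submod (D i), J `<=` D i & D i `<=` K]) ->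
    (forall i, D i `<=` D i.+1) ->
  exists i, D i.+1 `<=` D i.
Proof.
move=> [n len] Db DS; apply: contrapT => nD.
suff /len : chain K J n.+1 by rewrite ltnn.
by exists D => i _; [apply: Db|split=> // DD; apply: nD; exists i].
Qed.

End Length.

(** * Lengths under linear maps of subquotients *)

Section Transport.
Variables (A B B' : comNzRingType) (phi : {rmorphism A -> B}) (phi' : {rmorphism A -> B'}).
Variables (K J : set B) (K' J' : set B') (f : B -> B').
Hypotheses (sK : submod phi K) (sJ : submod phi J) (JK : J `<=` K).
Hypotheses (sK' : submod phi' K') (sJ' : submod phi' J') (JK' : J' `<=` K').
(** Linearity is asked on [K] only: the map [gr_monom n] used later takes a default value outside
    the n-th power of the ideal. *)
Hypothesis fD : forall u v, K u -> K v -> f (u + v) = f u + f v.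
Hypothesis fM : forall a u, K u -> f (phi a * u) = phi' a * f u.
Hypothesis fK : forall u, K u -> K' (f u).

Lemma lin0 : f 0 = 0.
Proof.
by have [K0 _ _] := sK; have := fM 0 K0; rewrite !rmorph0 !mul0r.
Qed.

Lemma linN u : K u -> f (- u) = - f u.
Proof. by move=> Ku; have := fM (-1) Ku; rewrite !rmorphN !rmorph1 !mulN1r. Qed.

Lemma linB u v : K u -> K v -> f (u - v) = f u - f v.
Proof.
move=> Ku Kv; rewrite fD ?linN //.
by rewrite -mulN1r -(rmorph1 phi) -rmorphN; case: sK => _ _; apply.
Qed.

Lemma submod_image S : submod phi S -> S `<=` K -> submod phi' (f @` S).
Proof.
move=> [S0 SD SM] SK; split.
- by exists 0 => //; apply: lin0.
- move=> _ _ [u Su <-] [v Sv <-]; exists (u + v); first exact: SD.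
  by apply: fD; apply: SK.
- move=> a _ [u Su <-]; exists (phi a * u); first exact: SM.
  by apply: fM; apply: SK.
Qed.

Lemma submod_preimage S : submod phi' S -> submod phi (K `&` (f @^-1` S)).
Proof.
move=> [S0 SD SM]; have [K0 KD KM] := sK; split.
- by split=> //; rewrite /preimage /= lin0.
- move=> u v [Ku Su] [Kv Sv]; split; first exact: KD.
  by rewrite /preimage /= fD //; apply: SD.
- move=> a u [Ku Su]; split; first exact: KM.
  by rewrite /preimage /= fM //; apply: SM.
Qed.

(** The induced map from [K / J] to [K' / J'] is injective, so inclusions stay strict after [J'] is
    added to the images. *)
Lemma chain_image k : (forall u, K u -> J' (f u) -> J u) ->
  chain phi K J k -> chain phi' (sumset (f @` K) J') J' k.
Proof.
move=> finj [C Cb Cs]; exists (fun i => sumset (f @` C i) J') => i ik.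
  have [sC JC CK] := Cb i ik; split.
  - by apply: submod_sumset => //; apply: submod_image.
  - by apply: sumsetr; apply: submod_image.
  - by move=> _ [_ [v [[u /CK Ku <-] J'v ->]]]; exists (f u), v; split=> //; exists u.
have [CC nCC] := Cs i ik; have [sC JC CK] := Cb i (ltnW ik).
have [sC1 JC1 CK1] := Cb i.+1 ik; split.
  by move=> _ [_ [v [[u /CC Ku <-] J'v ->]]]; exists (f u), v; split=> //; exists u.
move=> CC'; apply: nCC => u C1u.
have [|_ [v [[w Cw <-] J'v fuE]]] := CC' (f u).
  by apply: (sumsetl sJ'); exists u.
have Ju : J (u - w).
  apply: finj.
    by apply: (submodB sK); [apply: CK1|apply: CK].
  by rewrite linB; [rewrite fuE addrC addKr|apply: CK1|apply: CK].
have -> : u = u - w + w by rewrite subrK.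
by case: sC => _ CD _; apply: CD => //; apply: JC.
Qed.

(** The induced map from [K / J] to [K' / J'] is onto, so distinct submodules have distinct
    preimages. *)
Lemma chain_preimage k : (forall u, J u -> J' (f u)) ->
    (forall w, K' w -> exists2 u, K u & J' (w - f u)) ->
  chain phi' K' J' k -> chain phi K J k.
Proof.
move=> fJ fsurj [C Cb Cs]; exists (fun i => K `&` (f @^-1` C i)) => i ik.
  have [sC JC CK] := Cb i ik; split.
  - exact: submod_preimage.
  - by move=> u Ju; split; [apply: JK|apply/JC/fJ].
  - by move=> u [].
have [CC nCC] := Cs i ik; have [sC JC CK] := Cb i (ltnW ik).
have [sC1 JC1 CK1] := Cb i.+1 ik; split; first by move=> u [Ku /CC].
move=> CC'; apply: nCC => w C1w; have [u Ku J'u] := fsurj w (CK1 _ C1w).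
have C1u : C i.+1 (f u).
  have -> : f u = w - (w - f u) by rewrite subKr.
  by apply: (submodB sC1) => //; apply: JC1.
have [_ Cu] := CC' u (conj Ku C1u).
have -> : w = w - f u + f u by rewrite subrK.
by case: sC => _ CD _; apply: CD => //; apply: JC.
Qed.

Lemma lenle_surj n : (forall u, J u -> J' (f u)) ->
    (forall w, K' w -> exists2 u, K u & J' (w - f u)) ->
  lenle phi K J n -> lenle phi' K' J' n.
Proof. by move=> fJ fsurj len k /(chain_preimage fJ fsurj)/len. Qed.

Lemma mlen_inj : flen phi' K' J' -> (forall u, K u -> J' (f u) -> J u) ->
  (mlen phi K J <= mlen phi' (sumset (f @` K) J') J')%N.
Proof.
move=> fl finj; have sI : submod phi' (f @` K) by apply: submod_image.
have IK : sumset (f @` K) J' `<=` K'.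
  by apply: (sumset_sub sK') => // _ [u Ku <-]; apply: fK.
have IJ : J' `<=` sumset (f @` K) J' := sumsetr sI.
have fl' : flen phi' (sumset (f @` K) J') J' by apply: flen_sub fl.
have flK : flen phi K J.
  by exists (mlen phi' (sumset (f @` K) J') J') => k /(chain_image finj); apply: lenle_mlen.
apply: (lenle_mlen sJ' IJ fl'); apply: chain_image => //; exact: chain_mlen.
Qed.

Lemma mlen_inj_le : flen phi' K' J' -> (forall u, K u -> J' (f u) -> J u) ->
  (mlen phi K J <= mlen phi' K' J')%N.
Proof.
move=> fl finj; have sI : submod phi' (f @` K) by apply: submod_image.
have IK : sumset (f @` K) J' `<=` K'.
  by apply: (sumset_sub sK') => // _ [u Ku <-]; apply: fK.
have IJ : J' `<=` sumset (f @` K) J' := sumsetr sI.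
apply: leq_trans (mlen_inj fl finj) _.
by rewrite (mlen_add sJ' (submod_sumset sI sJ') sK') // leq_addr.
Qed.

Lemma mlen_surj_le : flen phi K J -> (forall u, J u -> J' (f u)) ->
    (forall w, K' w -> exists2 u, K u & J' (w - f u)) ->
  (mlen phi' K' J' <= mlen phi K J)%N.
Proof.
by move=> fl fJ fsurj; apply: mlen_le => //; apply: lenle_surj => //; apply: lenle_mlen.
Qed.

(** The image of an injection has at least the length of its source, so here it leaves no room in
    [K' / J']. *)
Lemma surj_of_mlen : flen phi' K' J' -> (forall u, K u -> J' (f u) -> J u) ->
  (mlen phi' K' J' <= mlen phi K J)%N -> forall w, K' w -> exists2 u, K u & J' (w - f u).
Proof.
move=> fl finj le w K'w; have sI : submod phi' (f @` K) by apply: submod_image.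
have IK : sumset (f @` K) J' `<=` K'.
  by apply: (sumset_sub sK') => // _ [u Ku <-]; apply: fK.
have IJ : J' `<=` sumset (f @` K) J' := sumsetr sI.
have /(_ w K'w)[_ [v [[u Ku <-] J'v ->]]] : K' `<=` sumset (f @` K) J'.
  apply: (mlen_supK sJ' (submod_sumset sI sJ') sK' IJ IK fl).
  exact: leq_trans le (mlen_inj fl finj).
by exists u => //; rewrite addrC addKr.
Qed.

End Transport.

(** * Ideals of a Noetherian local ring *)

Section IdealTheory.
Variable R : comNzRingType.
Implicit Types (I J K M P S X Y : set R) (s : seq R) (a u : R).

Lemma ideal_setI J K : ideal J -> ideal K -> ideal (J `&` K).
Proof. exact: (@submodI R R idfun). Qed.

Lemma ideal_sumset J K : ideal J -> ideal K -> ideal (sumset J K).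
Proof. exact: (@submod_sumset R R idfun). Qed.

Lemma ideal_chain_chain J K n C : ideal_chain J K n C -> chain idfun K J n.
Proof.
move=> [C0 Cn Ci Cs].
have up i j : (i <= j)%N -> (j <= n)%N -> C i `<=` C j.
  elim: j => [|j IHj]; first by rewrite leqn0 => /eqP-> _ u.
  rewrite leq_eqVlt => /orP[/eqP-> _ u //|ij] jn.
  by apply: subset_trans (IHj ij (ltnW jn)) _; case: (Cs j jn).
exists C => // i ik; split; first exact: Ci.
- by rewrite -C0; apply: up.
- by rewrite -Cn; apply: up.
Qed.

Lemma chain_ideal_chain J K n : ideal J -> ideal K -> J `<=` K ->
  chain idfun K J n.+1 -> exists C, ideal_chain J K n.+1 C.
Proof.
move=> iJ iK JK [C Cb Cs].
(* The two end terms are moved outwards to [J] and [K], which keeps the end steps strict. *)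
exists (fun i => if i is 0 then J else if (i <= n)%N then C i else K).
split=> [//||i ik|i ik]; first by rewrite ltnn.
  by case: i ik => [//|i] ik; case: ifP => // _; case: (Cb i.+1 ik).
have [CC nCC] := Cs i ik; have [_ JC CK] := Cb i (ltnW ik).
have [_ JC1 CK1] := Cb i.+1 ik.
case: i ik CC nCC JC CK JC1 CK1 => [|i] ik CC nCC JC CK JC1 CK1.
  case: ifP => _; (split; [by []|]) => sub; apply: nCC.
    exact: subset_trans JC.
  by apply: subset_trans JC; apply: subset_trans sub.
rewrite -ltnS ik; case: ifP => // _.
split=> // sub; apply: nCC; exact: subset_trans sub.
Qed.

(** The two notions of chain differ only in length 0, where [ideal_chain] forces [J = K]. The maxima
    agree, since a maximum of 0 for [chain] also forces [J = K]. *)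
Lemma quotient_lengthE J K : ideal J -> ideal K -> J `<=` K ->
  quotient_length K J = mlen idfun K J.
Proof.
move=> iJ iK JK; congr (xget _ _); apply/funext => n; apply/propext.
have key k : chain idfun K J k -> k = 0%N \/ exists C, ideal_chain J K k C.
  by case: k => [|k ch]; [left|right; apply: chain_ideal_chain].
have ch0 : chain idfun K J 0 by apply: chain0.
split=> -[En ub].
  by case: En => C /ideal_chain_chain ch; split=> // k /key[-> //|/ub].
have ub' k : (exists C, ideal_chain J K k C) -> (k <= n)%N.
  by move=> [C /ideal_chain_chain/ub].
split=> //; have [n0|//] := key n En.
rewrite n0 in ub *; have KJ : K `<=` J by apply: (lenle0 (phi := idfun) iJ iK JK) => k /ub.
by exists (fun=> J); split=> //; apply/seteqP.
Qed.

Lemma gen_ideal_sub J S : ideal J -> S `<=` J -> gen_ideal S `<=` J.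
Proof. by move=> iJ SJ; apply: smallest_sub. Qed.

Lemma mem_gen_ideal S a : S a -> gen_ideal S a.
Proof. by move=> Sa; apply: sub_gen_smallest. Qed.

Lemma gen_ideal1P a u : gen_ideal [set a] u <-> exists r, u = r * a.
Proof.
split=> [|[r ->]]; last by case: (gen_idealP [set a]) => _ _; apply; apply: mem_gen_ideal.

move: u; apply: gen_ideal_sub => [|_ ->]; last by exists 1; rewrite mul1r.
split=> [|_ _ [r ->] [r' ->]|c _ [r ->]]; first by exists 0; rewrite mul0r.
- by exists (r + r'); rewrite mulrDl.
- by exists (c * r); rewrite mulrA.
Qed.

Lemma gen_ideal_nil u : gen_ideal [set` [::]] u -> u = 0 :> R.
Proof.
move: u; apply: gen_ideal_sub => //.
split=> [//|u v /= -> ->|r u /= ->]; by rewrite ?addr0 ?mulr0.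
Qed.

Lemma gen_ideal_cons a s :
  gen_ideal [set` a :: s] `<=` sumset (gen_ideal [set a]) (gen_ideal [set` s]).
Proof.
apply: gen_ideal_sub; first exact: ideal_sumset (gen_idealP _) (gen_idealP _).
move=> u; rewrite /= inE => /orP[/eqP->|us].
  exact: (sumsetl (phi := idfun) (gen_idealP _)) (mem_gen_ideal _).
exact: (sumsetr (phi := idfun) (gen_idealP _)) (mem_gen_ideal _).
Qed.

Lemma gen_ideal_behead a s : gen_ideal [set` s] `<=` gen_ideal [set` a :: s].
Proof.
apply: gen_ideal_sub (gen_idealP _) _ => u us.
by apply: mem_gen_ideal; rewrite /= inE us orbT.
Qed.

Lemma gen_ideal_head a s : gen_ideal [set` a :: s] a.
Proof. by apply: mem_gen_ideal; rewrite /= inE eqxx. Qed.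

Lemma ideal_mul_sub I J K : ideal K -> (forall a b, I a -> J b -> K (a * b)) ->
  ideal_mul I J `<=` K.
Proof. by move=> iK IJK; apply: gen_ideal_sub => // _ [a [b [Ia Jb ->]]]; apply: IJK. Qed.

Lemma ideal_mulS I I' J J' : I `<=` I' -> J `<=` J' -> ideal_mul I J `<=` ideal_mul I' J'.
Proof.
move=> II' JJ'; apply: ideal_mul_sub; first exact: gen_idealP.
by move=> a b /II' I'a /JJ' J'b; apply: ideal_mul_mem.
Qed.

Lemma ideal_mul_subr I J : ideal J -> ideal_mul I J `<=` J.
Proof. by move=> iJ; apply: ideal_mul_sub => // a b _; case: iJ => _ _; apply. Qed.

Lemma ideal_exp1 I : ideal I -> ideal_exp I 1 = I.
Proof.
move=> iI; apply/seteqP; split; first exact: ideal_exp1_sub.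
by move=> u Iu; rewrite -[u]mulr1; apply: ideal_mul_mem.
Qed.

Lemma ideal_exp_le I i j : (i <= j)%N -> ideal_exp I j `<=` ideal_exp I i.
Proof.
elim: j => [|j IHj]; first by rewrite leqn0 => /eqP-> u.
rewrite leq_eqVlt => /orP[/eqP-> u //|/IHj sub].
exact: subset_trans (@ideal_expS_sub _ _ _) sub.
Qed.

Lemma ideal_exp_pow I n a : I a -> ideal_exp I n (a ^+ n).
Proof. by move=> Ia; elim: n => [//|n IHn]; rewrite exprS; apply: ideal_mul_mem. Qed.

Lemma ideal_expD_sub X K i j : ideal K ->
    (forall u v, ideal_exp X i u -> ideal_exp X j v -> K (u * v)) ->
  ideal_exp X (i + j) `<=` K.
Proof.
elim: i K => [|i IHi] K iK XK.
  by move=> v Xv; rewrite -[v]mul1r; apply: XK.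
have [K0 KD KM] := iK.
(* This is the colon ideal of [K] by [X]; it absorbs one factor of the power, so that the induction
   hypothesis applies. *)
pose K' := [set b | forall a, X a -> K (a * b)].
have iK' : ideal K'.
  split=> [a _|u v K'u K'v a Xa|r u K'u a Xa]; first by rewrite mulr0.
  - by rewrite mulrDr; apply: KD; [apply: K'u|apply: K'v].
  - by rewrite mulrCA; apply/KM/K'u.
apply: ideal_mul_sub => // a b Xa.
move=> /(IHi K' iK'); apply => // u v Xu Xv a' Xa'.
by rewrite mulrA; apply: XK => //; apply: ideal_mul_mem.
Qed.

Lemma ideal_expM_sub X Y b n : ideal_exp X b `<=` Y -> ideal_exp X (b * n) `<=` ideal_exp Y n.
Proof.
move=> XY; elim: n => [|n IHn]; first by rewrite muln0.
rewrite mulnS; apply: ideal_expD_sub; first exact: ideal_expP.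
by move=> u v /XY Yu /IHn; apply: ideal_mul_mem.
Qed.

(** If (s)^b and g^a lie in I, then (g, s)^b lies in I + (g), so its a-th power lies in I + (g^a),
    which is I. *)
Lemma fg_radical_pow s I : ideal I -> (forall a, a \in s -> radical I a) ->
  exists N, ideal_exp (gen_ideal [set` s]) N `<=` I.
Proof.
move=> iI; have [I0 ID IM] := iI; elim: s => [|g s IHs] rad.
  (* The exponent 0 would not do: the zeroth power is the whole ring. *)
  exists 1%N; apply: ideal_mul_sub => // a b /gen_ideal_nil -> _.
  by rewrite mul0r.
have [b bI] := IHs (fun a as_ => rad a (mem_behead (s := g :: s) as_)).
have [a Iga] := rad g (mem_head g s).
set X := gen_ideal _.
have iIg c : ideal (sumset I (gen_ideal [set c])) by apply: ideal_sumset (gen_idealP _).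
have Xb n : ideal_exp X n `<=` sumset (ideal_exp (gen_ideal [set` s]) n) (gen_ideal [set g]).
  elim: n => [|n IHn]; first by move=> u _; apply: (sumsetl (phi := idfun) (gen_idealP _)).
  apply: ideal_mul_sub; first exact: ideal_sumset (ideal_expP _ _) (gen_idealP _).
  move=> _ _ /gen_ideal_cons[_ [v [/gen_ideal1P[r ->] sv ->]]]
    /IHn[u' [_ [su /gen_ideal1P[r' ->] ->]]].
  exists (v * u'), ((r * u' + (r * g + v) * r') * g); split.
  - exact: ideal_mul_mem.
  - by apply/gen_ideal1P; exists (r * u' + (r * g + v) * r').
  - by ring.
have Xab n : ideal_exp X (b * n) `<=` sumset I (gen_ideal [set g ^+ n]).
  elim: n => [|n IHn].
    move=> u _; exists 0, u; rewrite add0r; split=> //.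
    by apply/gen_ideal1P; exists u; rewrite mulr1.
  rewrite mulnS; apply: ideal_expD_sub => // _ _ /Xb[i [_ [/bI Ii /gen_ideal1P[r ->] ->]]]
    /IHn[i' [_ [Ii' /gen_ideal1P[r' ->] ->]]].
  exists ((i' + r' * g ^+ n) * i + (r * g) * i'), ((r * r') * g ^+ n.+1); split.
  - by apply: ID; apply: IM.
  - by apply/gen_ideal1P; exists (r * r').
  - by rewrite exprS; ring.
exists (b * a)%N => u /Xab[i [_ [Ii /gen_ideal1P[r ->] ->]]].
by apply: ID => //; apply: IM.
Qed.

Lemma ideal_avoid J S : ideal J -> (forall a, J a -> ~ S a) ->
  exists P, [/\ ideal P, J `<=` P, forall a, P a -> ~ S a &
    forall K, ideal K -> P `<=` K -> (forall a, K a -> ~ S a) -> K `<=` P].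
Proof.
move=> iJ JS.
pose good X := [/\ ideal X, J `<=` X & forall a, X a -> ~ S a].
have goodJ : good J by split.
have [|P [PP maxP]] := @Zorn_bigcup _ [set X | X = set0 \/ good X].
  move=> F FP totF; have [[X FX gX]|nF] := pselect (exists2 X, F X & good X); last first.
    left; apply/seteqP; split=> // u [X FX Xu].
    case: (FP X FX) => [X0|gX]; first by rewrite X0 in Xu.
    by case: nF; exists X.
  right; have [[X0 XD XM] JX XS] := gX; split.
  - split; first by exists X.
    + move=> u v [Y FY Yu] [Z FZ Zv].
      have [YZ|ZY] := totF Y Z FY FZ.
        exists Z => //; case: (FP Z FZ) => [Z0|[[_ ZD _] _ _]]; first by rewrite Z0 in Zv.
        by apply: ZD => //; apply: YZ.
      exists Y => //; case: (FP Y FY) => [Y0|[[_ YD _] _ _]]; first by rewrite Y0 in Yu.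
      by apply: YD => //; apply: ZY.
    + move=> r u [Y FY Yu]; exists Y => //.
      by case: (FP Y FY) => [Y0|[[_ _ YM] _ _]]; [rewrite Y0 in Yu|apply: YM].
  - by apply: subset_trans JX _ => u Xu; exists X.
  - move=> a [Y FY Ya]; case: (FP Y FY) => [Y0|[_ _ YS]]; first by rewrite Y0 in Ya.
    exact: YS.
case: PP => [P0|[iP JP PS]].
  case: (maxP J); last by right.
  by rewrite P0; split=> // sub; apply: (sub 0); case: iJ.
exists P; split=> // K iK PK KS; apply: contrapT => nKP.
by apply: (maxP K) => //; right; split=> //; apply: subset_trans PK.
Qed.

Lemma ideal_setT1 J : ideal J -> J 1 -> J = setT.
Proof.
by move=> [_ _ JM] J1; apply/seteqP; split=> // u _; rewrite -[u]mulr1; apply: JM.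
Qed.

Lemma exists_maximal_ideal J : ideal J -> ~ J 1 -> exists2 M, maximal_ideal M & J `<=` M.
Proof.
move=> iJ nJ1; have [a Ja /= a1|P [iP JP nP1 maxP]] := @ideal_avoid J [set 1] iJ.
  by apply: nJ1; rewrite -a1.
exists P => //; split=> // [P1|K iK PK]; first exact: (nP1 1).
have [K1|nK1] := pselect (K 1); first by right; apply: ideal_setT1.
by left; apply/seteqP; split=> //; apply: maxP => // a Ka /= a1; apply: nK1; rewrite -a1.
Qed.

(** An ideal P maximal among those avoiding [S] is prime: if a and b are outside P, then P + (a) and
    P + (b) meet [S], and the product of the common elements lies in P + (ab). *)
Lemma exists_prime_ideal J S : ideal J -> S 1 -> (forall a b, S a -> S b -> S (a * b)) ->
    (forall a, J a -> ~ S a) ->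
  exists P, [/\ prime_ideal P, J `<=` P & forall a, P a -> ~ S a].
Proof.
move=> iJ S1 SM /(ideal_avoid iJ)[P [iP JP PS maxP]]; exists P; split=> //.
have [P0 PD PM] := iP.
have meets a : ~ P a -> exists p r, P p /\ S (p + r * a).
  move=> nPa; apply: contrapT => nS; apply: nPa.
  have iK := ideal_sumset iP (gen_idealP [set a]).
  apply: (maxP _ iK).
  - exact: (sumsetl (phi := idfun) (gen_idealP _)).
  - by move=> _ [p [_ [Pp /gen_ideal1P[r ->] ->]]] Sp; apply: nS; exists p, r.
  - exact: (sumsetr (phi := idfun) iP) (mem_gen_ideal _).
split=> // [P1|a b Pab]; first exact: (PS 1).
apply: contrapT => /not_orP[/meets[p [r [Pp Sp]]] /meets[q [t [Pq Sq]]]].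
apply: (PS _ _ (SM _ _ Sp Sq)).
have -> : (p + r * a) * (q + t * b) = (q + t * b) * p + (r * a) * q + (r * t) * (a * b).
  by ring.
by apply: (PD); [apply: (PD)|]; apply: PM.
Qed.

Lemma maximal_prime M : maximal_ideal M -> prime_ideal M.
Proof.
move=> [iM nM1 maxM]; have [|a Ma a1|P [pP MP _]] := @exists_prime_ideal M [set 1] iM erefl.
- by move=> a b /= -> ->; rewrite mulr1.
- by apply: nM1; rewrite -a1.
have [iP nP1 _] := pP; have [<-//|PT] := maxM P iP MP.
by case: nP1; rewrite PT.
Qed.

Lemma maximal_coprime M a : maximal_ideal M -> ~ M a -> exists b, M (1 - b * a).
Proof.
move=> [iM nM1 maxM] nMa; have iK := ideal_sumset iM (gen_idealP [set a]).
case: (maxM _ iK (sumsetl (phi := idfun) (gen_idealP _))) => KE.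
  case: nMa; rewrite -KE.
  exact: (sumsetr (phi := idfun) iM) (mem_gen_ideal _).
have : [set: R] 1 by [].
rewrite -KE => -[p [_ [Mp /gen_ideal1P[b ->] ->]]].
by exists b; rewrite addrK.
Qed.

Lemma noetherian_acc (J : nat -> set R) : noetherian R -> (forall i, ideal (J i)) ->
  (forall i, J i `<=` J i.+1) -> exists r, J r.+1 `<=` J r.
Proof.
move=> noeth iJ JS.
have up i j : (i <= j)%N -> J i `<=` J j.
  elim: j => [|j IHj]; first by rewrite leqn0 => /eqP-> u.
  by rewrite leq_eqVlt => /orP[/eqP-> u //|/IHj sub]; apply: subset_trans (JS j).
have iU : ideal [set u | exists i, J i u].
  split; first by exists 0%N; case: (iJ 0%N).
  - move=> u v [i Ju] [j Jv]; exists (maxn i j); case: (iJ (maxn i j)) => _ JD _.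
    by apply: JD; [apply: up Ju; apply: leq_maxl|apply: up Jv; apply: leq_maxr].
  - by move=> r u [i Ju]; exists i; case: (iJ i) => _ _; apply.
have [s sE] := noeth _ iU.
have sU : [set` s] `<=` [set u | exists i, J i u].
  by rewrite sE => u; apply: mem_gen_ideal.
have [r sr] : exists r, forall u, u \in s -> J r u.
  elim: s sU {sE} => [|g s IHs] sU; first by exists 0%N.
  have [r sr] := IHs (fun u us => sU u (mem_behead (s := g :: s) us)).
  have [i Jg] := sU g (mem_head g s).
  exists (maxn i r) => u; rewrite inE => /orP[/eqP->|/sr].
    by apply: up Jg; apply: leq_maxl.
  by apply: up; apply: leq_maxr.
exists r => u Ju; have : gen_ideal [set` s] u by rewrite -sE; exists r.+1.
exact: gen_ideal_sub.
Qed.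

End IdealTheory.

(** * Nakayama's lemma and finite length over a local ring *)

Section LocalRing.
Variables (A : comNzRingType) (m : set A).
Hypothesis mloc : local_ring m.
Implicit Types (I J K : set A) (s : seq A) (a : A).

Lemma local_maximal : maximal_ideal m.
Proof. exact/mloc. Qed.

Lemma local_ideal : ideal m.
Proof. by case: local_maximal. Qed.

Lemma local_unit a : ~ m a -> exists b, b * a = 1.
Proof.
move=> nma; have [/gen_ideal1P[b ->]|ng1] := pselect (gen_ideal [set a] 1); first by exists b.
have [M /mloc-> sub] := exists_maximal_ideal (gen_idealP _) ng1.
by case: nma; apply: sub; apply: mem_gen_ideal.
Qed.

(** Induction on the generators. With N = J + m(s), the generator g satisfies g = rg + w with r in m
    and w in N; since 1 - r is a unit, g lies in N. Then (s) lies in N too, and the induction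
    hypothesis applies to s. *)
Lemma nakayama J s : ideal J ->
  gen_ideal [set` s] `<=` sumset J (ideal_mul m (gen_ideal [set` s])) ->
  gen_ideal [set` s] `<=` J.
Proof.
have [m0 mD mM] := local_ideal; elim: s => [|g s IHs] iJ sub.
  by move=> u /gen_ideal_nil->; case: iJ.
have [J0 JD JM] := iJ; have iG := gen_idealP [set` s].
have iN : ideal (sumset J (ideal_mul m (gen_ideal [set` s]))).
  exact: ideal_sumset (gen_idealP _).
have [N0 ND NM] := iN; set N := sumset _ _ in N0 ND NM iN.
have dec u : gen_ideal [set` g :: s] u -> exists r w, [/\ m r, N w & u = r * g + w].
  move=> /sub[j [v [Jj + ->]]].
  suff: ideal_mul m (gen_ideal [set` g :: s]) `<=`
      sumset [set r * g | r in m] (ideal_mul m (gen_ideal [set` s])).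
    move=> /[apply] -[_ [w [[r mr <-] sw ->]]].
    exists r, (j + w); split=> //; last by rewrite addrCA.
    by exists j, w.
  apply: ideal_mul_sub.
    apply: ideal_sumset; last exact: gen_idealP.
    split=> [|_ _ [r mr <-] [r' mr' <-]|c _ [r mr <-]].
    - by exists 0; rewrite ?mul0r.
    - by exists (r + r'); [apply: mD|rewrite mulrDl].
    - by exists (c * r); [apply: mM|rewrite mulrA].
  move=> a b ma /gen_ideal_cons[_ [v' [/gen_ideal1P[r ->] sv ->]]].
  exists (a * r * g), (a * v'); split; last by rewrite mulrDr mulrA.
    by exists (a * r) => //; rewrite mulrC; apply: mM.
  exact: ideal_mul_mem.
have Ng : N g.
  have [r [w [mr Nw gE]]] := dec g (@gen_ideal_head _ g s).
  have [m1r|b b1] := @local_unit (1 - r).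
    have [_ nm1 _] := local_maximal; apply: nm1.
    by rewrite -(subrK r 1); apply: mD.
  have -> : g = b * w.
    have <- : (1 - r) * g = w by rewrite mulrBl mul1r {1}gE addrAC subrr add0r.
    by rewrite mulrA b1 mul1r.
  exact: NM.
have sJ : gen_ideal [set` s] `<=` J.
  apply: IHs => // u su.
  have [r [w [mr Nw ->]]] := dec u (gen_ideal_behead su).
  by apply: ND => //; apply: NM.
have gJ : J g.
  case: Ng => j [w [Jj mw ->]]; apply: JD => //.
  by apply: sJ; apply: ideal_mul_subr mw.
apply: gen_ideal_sub => // u; rewrite /= inE => /orP[/eqP->//|us].
by apply: sJ; apply: mem_gen_ideal.
Qed.

Lemma flen_self K : flen idfun K K.
Proof. by exists 0%N; apply: lenlexx. Qed.

(** The quotient is killed by m, so each generator adds at most 1 to the length. *)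
Lemma flen_fg s J : ideal J -> ideal_mul m (gen_ideal [set` s]) `<=` J ->
  flen idfun (sumset J (gen_ideal [set` s])) J.
Proof.
elim: s J => [|g s IHs] J iJ msJ.
  apply: (@flen_sub _ _ _ J J) => //; last exact: flen_self.
  by apply: (sumset_sub (phi := idfun)) => // u /gen_ideal_nil->; case: iJ.
have igJ := ideal_sumset iJ (gen_idealP [set g]).
set J1 := sumset _ _ in igJ.
have JJ1 : J `<=` J1 := sumsetl (phi := idfun) (gen_idealP _).
apply: (@flen_sub _ _ _ (sumset J1 (gen_ideal [set` s])) J) => //.
  apply: (sumset_sub (phi := idfun)); first exact: ideal_sumset (gen_idealP _).
    exact: subset_trans (sumsetl (phi := idfun) (gen_idealP _)).
  apply: subset_trans (@gen_ideal_cons _ _ _) _ => _ [u [v [gu sv ->]]].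
  by exists u, v; split=> //; apply: (sumsetr (phi := idfun) iJ).
apply: (flen_add (K := J1)) => //.
- exact: ideal_sumset (gen_idealP _).
- exact: (sumsetl (phi := idfun) (gen_idealP _)).
(* The quotient (J + (g)) / J is zero or simple: an element j + rg of [C 1] outside [C 0] has r a
   unit, so [C 1] contains g and no step can follow. *)
- exists 1%N => k [C Cb Cs]; rewrite leqNgt; apply/negP => k1.
  have [sC0 JC0 _] := Cb 0%N (leq0n k); have [sC1 JC1 C1J] := Cb 1%N (ltnW k1).
  have [_ nC] := Cs 1%N k1; apply: nC.
  have [_ _ C2J] := Cb 2%N k1; apply: subset_trans C2J _.
  have [_ nC0] := Cs 0%N (ltnW k1).
  have [u [C1u nC0u]] : exists u, C 1%N u /\ ~ C 0%N u.
    by apply: contrapT => nE; apply: nC0 => u C1u; apply: contrapT => nC0u; apply: nE; exists u.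
  have [j [_ [Jj /gen_ideal1P[r ->] uE]]] := C1J u C1u.
  have nmr : ~ m r.
    move=> mr; apply: nC0u; rewrite uE; apply: JC0.
    have [_ JD _] := iJ; apply: JD => //; apply: msJ.
    by apply: ideal_mul_mem => //; apply: gen_ideal_head.
  have [b b1] := local_unit nmr.
  apply: (sumset_sub (phi := idfun)) => // _ /gen_ideal1P[c ->].
  have C1rg : C 1%N (r * g).
    have -> : r * g = u - j by rewrite uE addrC addKr.
    by apply: (submodB sC1) => //; apply: JC1.
  have -> : c * g = (c * b) * (r * g) by rewrite mulrA -(mulrA c) b1 mulr1.
  by case: sC1 => _ _; apply.
- apply: IHs => // u mu; apply: JJ1; apply: msJ; move: u mu.
  by apply: ideal_mulS => // u; apply: gen_ideal_behead.
Qed.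

Hypothesis noethA : noetherian A.

Lemma flen_exp_max N : flen idfun setT (ideal_exp m N).
Proof.
elim: N => [|N IHN]; first exact: flen_self.
have [s sE] := noethA (ideal_expP m N).
apply: (flen_add (K := ideal_exp m N)) => //; try exact: ideal_expP; try exact: ideal_setT.
  exact: ideal_expS_sub.
apply: (@flen_sub _ _ _ (sumset (ideal_exp m N.+1) (gen_ideal [set` s])) (ideal_exp m N.+1)) => //.
  rewrite {1}sE; exact: (sumsetr (phi := idfun) (ideal_expP m N.+1)).
by apply: flen_fg; [exact: ideal_expP|rewrite -sE].
Qed.

Lemma primary_pow I : primary_to m I -> exists N, ideal_exp m N `<=` I.
Proof.
move=> [[iI _ _] radI]; have [s sE] := noethA local_ideal.
rewrite [in X in exists N, ideal_exp X N `<=` _]sE; apply: fg_radical_pow => // a as_.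
by rewrite radI sE; apply: mem_gen_ideal.
Qed.

Lemma flen_exp I n : primary_to m I -> flen idfun setT (ideal_exp I n).
Proof.
move=> /primary_pow[N mNI].
by apply: flen_sub (flen_exp_max (N * n)) => //; apply: ideal_expM_sub.
Qed.

(** Depth equals height at m and the height is positive, so a regular sequence in m has a first
    element. *)
Lemma cm_dim1_regular : cohen_macaulay A -> krull_dim A 1 ->
  exists y, m y /\ forall u, y * u = 0 -> u = 0.
Proof.
move=> [_ cm] [[P [pP sP]] _].
have [n [[[s [sn [_ sreg] sm]] _] [_ ht]]] := cm m local_maximal.
have n0 : (0 < n)%N.
  (* The chain P 0 < P 1 given by the Krull dimension has P 1 inside m, so P 0 < m. *)
  apply: ht; exists (fun i => if i is 0 then P 0%N else m); split=> //; split=> [[|i] _|[|//] _].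
  - exact: pP.
  - exact: maximal_prime local_maximal.
  - have [P0 P01] := sP 0%N isT; have [iP1 nP1 _] := pP 1%N isT.
    have [M /mloc-> sub] := exists_maximal_ideal iP1 nP1.
    by split; [exact: subset_trans sub|move=> mP; apply: P01; exact: subset_trans mP].
case: s sn sreg sm => [n0'|y s _ sreg sm]; first by rewrite -n0' in n0.
exists y; split; first by apply: sm; rewrite /= inE eqxx.
move=> u yu; apply: gen_ideal_nil; apply: (sreg 0%N isT u) => /=.
by rewrite yu; case: (gen_idealP [set` Nil A]).
Qed.

End LocalRing.

(** * Reductions *)

Section Reduction.
Variables (A : comNzRingType) (m I : set A).
Hypotheses (mloc : local_ring m) (noethA : noetherian A) (primI : primary_to m I).
Implicit Types (K : set A) (s : seq A).

Let lam := mlen (idfun : A -> A).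

Lemma primary_ideal_sub : ideal I /\ I `<=` m.
Proof.
have [[iI nI1 _] _] := primI; split=> //.
by have [M /mloc->] := exists_maximal_ideal iI nI1.
Qed.

Lemma hilbert_funE n : hilbert_fun I n = lam (ideal_exp I n) (ideal_exp I n.+1).
Proof. by apply: quotient_lengthE; [exact: ideal_expP|exact: ideal_expP|exact: ideal_expS_sub]. Qed.

Lemma flen_sub_exp J K n : ideal_exp I n `<=` J -> flen idfun K J.
Proof. by move=> IJ; apply: (flen_sub IJ) (flen_exp mloc noethA n primI). Qed.

Definition scale (a : A) K : set A := (fun k => a * k) @` K.

Lemma ideal_scale a K : ideal K -> ideal (scale a K).
Proof.
move=> [K0 KD KM]; split=> [|_ _ [k Kk <-] [l Kl <-]|r _ [k Kk <-]].
- by exists 0; rewrite ?mulr0.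
- by exists (k + l); [apply: KD|rewrite mulrDr].
- by exists (r * k); [apply: KM|rewrite mulrCA].
Qed.

Lemma scale_sub a K : ideal K -> scale a K `<=` K.
Proof. by move=> [_ _ KM] _ [k Kk <-]; apply: KM. Qed.

Lemma ideal_mul_cons g s K : ideal K ->
  ideal_mul (gen_ideal [set` g :: s]) K = sumset (scale g K) (ideal_mul (gen_ideal [set` s]) K).
Proof.
move=> iK; have [K0 KD KM] := iK.
have iS : ideal (sumset (scale g K) (ideal_mul (gen_ideal [set` s]) K)).
  by apply: ideal_sumset (gen_idealP _); apply: ideal_scale.
apply/seteqP; split.
  apply: ideal_mul_sub => // _ k /gen_ideal_cons[_ [v [/gen_ideal1P[r ->] sv ->]]] Kk.
  exists (g * (r * k)), (v * k); split; last by ring.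
    by exists (r * k) => //; apply: KM.
  exact: ideal_mul_mem.
apply: (sumset_sub (phi := idfun)); first exact: gen_idealP.
  by move=> _ [k Kk <-]; apply: ideal_mul_mem => //; apply: gen_ideal_head.
by apply: ideal_mulS => // u; apply: gen_ideal_behead.
Qed.

Definition reduces s n : Prop :=
  ideal_exp I n.+1 `<=` ideal_mul (gen_ideal [set` s]) (ideal_exp I n).

Lemma reduces_le s n n' : (n <= n')%N -> reduces s n -> reduces s n'.
Proof.
elim: n' => [|n' IHn]; first by rewrite leqn0 => /eqP->.
rewrite leq_eqVlt => /orP[/eqP->//|le_n red].
apply: ideal_mul_sub => [|a b Ia]; first exact: gen_idealP.
move=> /(IHn le_n red); move: b; rewrite /=.
have [K0 KD KM] : ideal (ideal_mul (gen_ideal [set` s]) (ideal_exp I n'.+1)) by exact: gen_idealP.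
apply: gen_ideal_sub => [|_ [g [b [sg Ib ->]]]] /=.
  split=> [|u v /= Ku Kv|r u /= Ku]; rewrite ?mulr0 ?mulrDr //; first exact: KD.
  by rewrite mulrCA; apply: KM.
by rewrite mulrCA; apply: ideal_mul_mem => //; apply: ideal_mul_mem.
Qed.

(** * Replacement of two generators by one *)

Section Step.
Variables (u v : A) (s : seq A) (c : nat -> A) (e n0 : nat).
Hypotheses (Iu : I u) (Iv : I v) (Is : [set` s] `<=` I).
Hypothesis c_indep : forall i j, i != j -> ~ m (c i - c j).
Hypothesis lam_le : forall n, (lam (ideal_exp I n) (ideal_exp I n.+1) <= e)%N.
Hypothesis red : forall n, (n0 <= n)%N -> reduces [:: u, v & s] n.

Let L n := ideal_mul (gen_ideal [set` s]) (ideal_exp I n).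
Let pencil j := u + c j * v.
(** The summand I^(n+2) lets the ideals [a j n] be counted inside I^(n+1) / I^(n+2); Nakayama's
    lemma removes it afterwards. *)
Let a j n := sumset (sumset (scale (pencil j) (ideal_exp I n)) (L n)) (ideal_exp I n.+2).
Let f l := \prod_(i < l) pencil i.

Let ideal_a j n : ideal (a j n).
Proof.
apply: ideal_sumset (ideal_expP _ _); apply: ideal_sumset (gen_idealP _).
by apply: ideal_scale; apply: ideal_expP.
Qed.

Let a_pencil j n p : ideal_exp I n p -> a j n (pencil j * p).
Proof.
move=> Ip; apply: (sumsetl (phi := idfun)); first exact: ideal_expP.
by apply: (sumsetl (phi := idfun)); [exact: gen_idealP|exists p].
Qed.

Let a_L j n l : L n l -> a j n l.
Proof.
move=> Ll; apply: (sumsetl (phi := idfun)); first exact: ideal_expP.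
by apply: (sumsetr (phi := idfun)) => //; apply: ideal_scale; apply: ideal_expP.
Qed.

Let I_pencil j : I (pencil j).
Proof. by have [[_ ID IM] _] := primary_ideal_sub; apply: ID => //; apply: IM. Qed.

Let I_f l t y : ideal_exp I t y -> ideal_exp I (l + t) (f l * y).
Proof.
move=> Iy; elim: l => [|l IHl]; first by rewrite /f big_ord0 mul1r.
rewrite /f big_ord_recr /= -mulrA mulrCA; exact: ideal_mul_mem.
Qed.

Let f_a n l t y i : (l + t = n.+1)%N -> (i < l)%N -> ideal_exp I t y -> a i n (f l * y).
Proof.
elim: l t y => // l IHl t y lt il Iy.
rewrite /f big_ord_recr /= -/(f l) -mulrA.
move: il; rewrite ltnS leq_eqVlt => /orP[/eqP->|il].
  rewrite mulrCA; apply: a_pencil.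
  have nE : n = (l + t)%N by lia.
  by rewrite nE; apply: I_f.
by apply: (IHl t.+1) => //; [lia|apply: ideal_mul_mem].
Qed.

(** Modulo [pencil j], the generator u is a multiple of v. Each use of [red] thus trades one power
    of I for one factor v, up to an element of [a j n]. *)
Let pow_v j n k t : (n0 <= t)%N -> (k + t = n.+1)%N ->
  ideal_exp I n.+1 `<=` sumset (a j n) (scale (v ^+ k) (ideal_exp I t)).
Proof.
have [_ aD aM] := ideal_a j n.
elim: k t => [|k IHk] t n0t kt.
  rewrite add0n in kt; rewrite kt => z Iz; apply: (sumsetr (phi := idfun) (ideal_a j n)).
  by exists z => //; rewrite mul1r.
have kt' : (k + t.+1 = n.+1)%N by lia.
move=> _ /(IHk t.+1 (leqW n0t) kt')[z [_ [az [w Iw <-] ->]]].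
have := red n0t Iw; rewrite !ideal_mul_cons; try exact: ideal_expP.
move=> [_ [_ [[p Ip <-] [_ [l [[q Iq <-] Ll ->]]] ->]]].
have vI x : ideal_exp I t x -> ideal_exp I n (v ^+ k * x).
  have nE : n = (k + t)%N by lia.
  by rewrite nE => Ix; apply: ideal_exp_mem => //; apply: ideal_exp_pow.
(* From up + vq + l = [pencil j] p + v (q - [c j] p) + l, multiplied by v^k. *)
exists (z + (pencil j * (v ^+ k * p) + v ^+ k * l)), (v ^+ k.+1 * (q - c j * p)); split.
- apply: (aD _ _ az); apply: (aD); first by apply: a_pencil; apply: vI.
  apply: a_L; move: l Ll.
  apply: ideal_mul_sub => [|g b sg Ib].
    have [L0 LD LM] : ideal (L n) by exact: gen_idealP.
    split=> /= [|b b' Lb Lb'|r b Lb]; rewrite ?mulr0 ?mulrDr //; first exact: LD.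
    by rewrite mulrCA; apply: LM.
  by rewrite /= mulrCA; apply: ideal_mul_mem => //; apply: vI.
- exists (q - c j * p) => //; apply: ideal_sub (ideal_expP _ _) Iq _.
  by case: (ideal_expP I t) => _ _; apply.
- by rewrite /pencil exprS; ring.
Qed.

(** Each factor is [pencil i] = [pencil j] + ([c i] - [c j]) v, and multiples of [pencil j] are
    absorbed by [a j n]. *)
Let f_pow_v j n l t y : (l + t = n.+1)%N -> ideal_exp I t y ->
  a j n (f l * y - (\prod_(i < l) (c i - c j)) * v ^+ l * y).
Proof.
have [a0 aD aM] := ideal_a j n.
elim: l t y => [|l IHl] t y lt Iy.
  by rewrite /f !big_ord0 !mul1r subrr.
rewrite /f !big_ord_recr /= -/(f l); set d := \prod_(i < l) _.
have -> : f l * pencil l * y - d * (c l - c j) * v ^+ l.+1 * y =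
    pencil j * (f l * y) + (c l - c j) * (f l * (v * y) - d * v ^+ l * (v * y)).
  by rewrite /pencil exprS; ring.
apply: (aD).
  apply: a_pencil; have nE : n = (l + t)%N by lia.
  rewrite nE; exact: (I_f l Iy).
by apply/aM/(IHl t.+1); [lia|apply: ideal_mul_mem].
Qed.

Let unit_prod j l : (l <= j)%N -> exists b, b * \prod_(i < l) (c i - c j) = 1.
Proof.
elim: l => [|l IHl] lj; first by exists 1; rewrite big_ord0 mulr1.
have [b b1] := IHl (ltnW lj).
have [|b' b'1] := @local_unit _ _ mloc (c l - c j).
  by apply: c_indep; rewrite neq_ltn lj.
by exists (b * b'); rewrite big_ord_recr /= mulrACA b1 b'1 mulr1.
Qed.

(* Modulo (pencil j), each other factor of f j is a unit times v, so an
   inclusion of f j * I^t in a j n spreads to all of I^(n+1). *)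
Let f_sub_a j n t : (n0 <= t)%N -> (j + t = n.+1)%N ->
  (forall y, ideal_exp I t y -> a j n (f j * y)) -> ideal_exp I n.+1 `<=` a j n.
Proof.
move=> n0t jt fa z /(pow_v j n0t jt)[w [_ [aw [y Iy <-] ->]]].
have [_ aD aM] := ideal_a j n; apply: aD aw _.
have [b b1] := unit_prod (leqnn j).
have := aM b _ (ideal_sub (ideal_a j n) (fa y Iy) (f_pow_v j jt Iy)).
by rewrite subKr !mulrA b1 mul1r.
Qed.

(** The intersections of I^(n+1) with the first j ideals [a i n]. They contain [f j] I^t for j + t =
    n + 1, because each [pencil i] with i < j divides [f j]. *)
Let S n := fix S j := if j is j'.+1 then S j' `&` a j' n else ideal_exp I n.+1.

Lemma pencil_reduces : exists j n, reduces (pencil j :: s) n.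
Proof.
apply: contrapT => nred.
(* An inclusion modulo I^(n+2) would already give a reduction, by Nakayama's lemma. *)
have na j n : ~ (ideal_exp I n.+1 `<=` a j n).
  move=> sub; apply: nred; exists j, n.
  rewrite /reduces ideal_mul_cons; last exact: ideal_expP.
  have [g gE] := noethA (ideal_expP I n.+1); rewrite gE.
  apply: (nakayama mloc).
    by apply: ideal_sumset (gen_idealP _); apply: ideal_scale; apply: ideal_expP.
  rewrite -gE; apply: subset_trans sub _ => _ [w [z [aw Iz ->]]].
  exists w, z; split=> //; have [_ Im] := primary_ideal_sub.
  exact: (ideal_mulS Im) Iz.
(* Large enough that t = n + 1 - j stays above [n0] for every j up to e, as [f_sub_a] requires. *)
pose n := (n0 + e)%N.
have iS j : ideal (S n j).
  by elim: j => [|j IHj]; [exact: ideal_expP|exact: ideal_setI].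
have Ia j : ideal_exp I n.+2 `<=` a j n.
  apply: (sumsetr (phi := idfun)); apply: ideal_sumset (gen_idealP _).
  by apply: ideal_scale; apply: ideal_expP.
have IS j : ideal_exp I n.+2 `<=` S n j.
  elim: j => [|j IHj]; first exact: ideal_expS_sub.
  by move=> z Iz; split; [apply: IHj|apply: Ia].
have SI j : S n j `<=` ideal_exp I n.+1.
  by elim: j => [//|j IHj] z [/IHj].
have fS j t y : (j + t = n.+1)%N -> ideal_exp I t y ->
    forall l, (l <= j)%N -> S n l (f j * y).
  move=> jt Iy; elim=> [|l IHl] lj; first by have := I_f j Iy; rewrite jt.
  by split; [apply: IHl; apply: ltnW|apply: f_a jt lj Iy].
have Sstrict j : (j <= e)%N -> S n j.+1 `<` S n j.
  move=> je; split; first by move=> z [].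
  move=> sub; apply: (na j n); apply: (@f_sub_a j n (n.+1 - j)).
  - by rewrite /n; lia.
  - by rewrite /n; lia.
  - move=> y Iy; have : S n j (f j * y).
      by apply: (fS j (n.+1 - j)%N) => //; rewrite /n; lia.
    by move/sub => [].
have ch : chain idfun (ideal_exp I n.+1) (ideal_exp I n.+2) e.+1.
  exists (fun i => S n (e.+1 - i)%N) => i ie; first by split; [exact: iS|exact: IS|exact: SI].
  by rewrite subSS subSn //; apply: Sstrict; apply: leq_subr.
have sub2 := @ideal_expS_sub _ I n.+1.
have fl : flen idfun (ideal_exp I n.+1) (ideal_exp I n.+2)  by apply: (@flen_sub_exp _ _ n.+2).
have := lenle_mlen (phi := idfun) (ideal_expP I n.+2) sub2 fl ch.
by move/leq_trans/(_ (lam_le n.+1)); rewrite ltnn.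
Qed.

End Step.

(** Induction on the number of elements, starting from generators of I; [pencil_reduces] merges the
    first two as long as there are two. *)
Lemma exists_principal_reduction (c : nat -> A) (e : nat) :
    (forall i j, i != j -> ~ m (c i - c j)) ->
    (forall n, (lam (ideal_exp I n) (ideal_exp I n.+1) <= e)%N) ->
  exists x n0, I x /\ forall n, (n0 <= n)%N -> reduces [:: x] n.
Proof.
move=> c_indep lam_le; have [iI _] := primary_ideal_sub.
have [I0 ID IM] := iI.
suff main : forall k s n0, (size s <= k)%N -> [set` s] `<=` I ->
    (forall n, (n0 <= n)%N -> reduces s n) ->
    exists x n0, I x /\ forall n, (n0 <= n)%N -> reduces [:: x] n.
  have [s sE] := noethA iI.
  apply: (main (size s) s 0%N) => // [u us|n _].
    by rewrite sE; apply: mem_gen_ideal.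
  by rewrite /reduces -sE.
elim=> [|k IHk] [|u [|v s]] n0 // sk Is red;
  try by exists u, n0; split=> //; apply: Is; apply: mem_head.
(* If the list is empty, the element 0 can be added to it. *)
- exists 0, n0; split=> // n /red; rewrite /reduces => /subset_trans; apply.
  by apply: ideal_mulS => // w; apply: gen_ideal_behead.
- exists 0, n0; split=> // n /red; rewrite /reduces => /subset_trans; apply.
  by apply: ideal_mulS => // w; apply: gen_ideal_behead.
have Iu : I u by apply: Is; rewrite /= inE eqxx.
have Iv : I v by apply: Is; rewrite /= !inE eqxx orbT.
have Is' : [set` s] `<=` I by move=> w ws; apply: Is; rewrite /= !inE [w \in s]ws !orbT.
have [j [n1 red1]] := pencil_reduces Iu Iv c_indep lam_le red.
apply: (IHk (u + c j * v :: s) n1) => // [w|n n1n].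
  by rewrite /= inE => /orP[/eqP->|/Is'//]; apply: ID => //; apply: IM.
exact: reduces_le n1n red1.
Qed.

End Reduction.

(** * Lengths and integrality for a principal reduction *)

Section PrincipalReduction.
Variables (A : comNzRingType) (m I : set A).
Hypotheses (mloc : local_ring m) (noethA : noetherian A) (primI : primary_to m I).
Variables (x y : A) (n0 : nat).
Hypotheses (Ix : I x) (my : m y) (y_reg : forall u, y * u = 0 -> u = 0).
Hypothesis red : forall n, (n0 <= n)%N -> reduces I [:: x] n.

Let lam := mlen (idfun : A -> A).
Let iI : ideal I := proj1 (primary_ideal_sub mloc primI).
Let iE n : ideal (ideal_exp I n) := ideal_expP I n.
Let isc (K : set A) (iK : ideal K) : ideal (scale x K) := ideal_scale x iK.

Lemma reduces_scale n : (n0 <= n)%N -> ideal_exp I n.+1 `<=` scale x (ideal_exp I n).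
Proof.
move=> /red; rewrite /reduces ideal_mul_cons //.
move=> sub z /sub[_ [w [[u Iu <-] w0 ->]]]; exists u => //.
suff -> : w = 0 by rewrite addr0.
move: w w0; apply: ideal_mul_sub => [|a b /gen_ideal_nil -> _]; last by rewrite mul0r.
by split=> // [a b -> ->|a b ->]; rewrite ?addr0 ?mulr0.
Qed.

Lemma scale_exp n : scale x (ideal_exp I n) `<=` ideal_exp I n.+1.
Proof. by move=> _ [u Iu <-]; apply: ideal_mul_mem. Qed.

(** Some power of m lies in I, so a power of y lies in I^(n0+1) and hence in (x). If xu = 0, that
    power kills u, and y is regular. *)
Lemma reduction_regular u : x * u = 0 -> u = 0.
Proof.
move=> xu; have [N mN] := primary_pow mloc noethA primI.
have /(reduces_scale (leqnn n0))[w _ yE] : ideal_exp I n0.+1 (y ^+ (N * n0.+1)).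
  by apply: (ideal_expM_sub mN); apply: ideal_exp_pow.
have: y ^+ (N * n0.+1) * u = 0 by rewrite -yE mulrAC xu mul0r.
elim: (N * n0.+1)%N => [|k IHk]; first by rewrite mul1r.
by rewrite exprS -mulrA => /y_reg.
Qed.

Lemma exp_sub_scale K n : ideal_exp I n `<=` K -> exists k, ideal_exp I k `<=` scale x K.
Proof.
move=> IK; exists (maxn n n0).+1 => z /(reduces_scale (leq_maxr _ _))[u Iu <-].
by exists u => //; apply/IK/(ideal_exp_le (leq_maxl n n0)).
Qed.

(** Multiplication by x identifies A / K with xA / xK. Computing the length of A / xK through K and
    through xA then gives the claim. *)
Lemma lam_scale K n : ideal K -> ideal_exp I n `<=` K ->
  lam K (scale x K) = lam setT (scale x setT).
Proof.
move=> iK IK; have [k Ik] := exp_sub_scale IK.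
have fl L : flen idfun L (scale x K) by apply: (flen_sub_exp mloc noethA primI _ Ik).
have flK L : flen idfun L K by apply: (flen_sub_exp mloc noethA primI _ IK).
have scK := scale_sub (a := x) iK.
have scT : scale x K `<=` scale x setT by move=> _ [u _ <-]; exists u.
have iT := @ideal_setT A.
have scE : lam (scale x setT) (scale x K) = lam setT K.
  apply/eqP; rewrite eqn_leq; apply/andP; split.
    apply: (mlen_surj_le (phi := idfun) (phi' := idfun) (f := fun u => x * u)) => //.
    - exact: (isc iK).
    - by move=> u v _ _; rewrite mulrDr.
    - by move=> a u _; rewrite mulrCA.
    - by move=> u Ku; exists u.
    - by move=> _ [u _ <-]; exists u => //; rewrite subrr; case: (isc iK).
  apply: (mlen_inj_le (phi := idfun) (phi' := idfun) (f := fun u => x * u)) => //.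
  - exact: (isc iT).
  - exact: (isc iK).
  - by move=> u v _ _; rewrite mulrDr.
  - by move=> a u _; rewrite mulrCA.
  - by move=> u _; exists u.
  - move=> u _ [v Kv /eqP]; rewrite eq_sym -subr_eq0 -mulrBr => /eqP/reduction_regular/eqP.
    by rewrite subr_eq0 => /eqP->.
have := mlen_add (phi := idfun) (isc iK) iK iT scK (@subsetT _ _) (fl _).
rewrite (mlen_add (phi := idfun) (isc iK) (isc iT) iT scT (@subsetT _ _) (fl _)).
by rewrite -!/lam scE /lam => /eqP; rewrite addnC eqn_add2r => /eqP->.
Qed.

(** These are the numbers v_n of the overview. *)
Definition defect n : nat := lam (ideal_exp I n.+1) (scale x (ideal_exp I n)).

Lemma flen_scale_exp L n : flen idfun L (scale x (ideal_exp I n)).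
Proof.
by have [k Ik] := exp_sub_scale (fun z (h : ideal_exp I n z) => h);
  apply: (flen_sub_exp mloc noethA primI _ Ik).
Qed.

Lemma hilbert_fun_defect n : (hilbert_fun I n + defect n)%N = lam setT (scale x setT).
Proof.
rewrite hilbert_funE -(lam_scale (iE n) (fun z h => h)) addnC.
by rewrite -(mlen_add (phi := idfun) (isc (iE n)) (iE n.+1) (iE n) (@scale_exp n)
  (@ideal_expS_sub _ I n) (@flen_scale_exp _ n)).
Qed.

Lemma defect0 n : (n0 <= n)%N -> defect n = 0%N.
Proof.
move=> nn0; rewrite /defect.
have -> : scale x (ideal_exp I n) = ideal_exp I n.+1.
  by apply/seteqP; split; [exact: scale_exp|exact: reduces_scale].
exact: (mlenxx (phi := idfun) (iE n.+1)).
Qed.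

Lemma defect0_scale n : defect n = 0%N -> ideal_exp I n.+1 `<=` scale x (ideal_exp I n).
Proof.
exact: (mlen_eq0 (phi := idfun) (isc (iE n)) (iE n.+1) (@scale_exp n) (@flen_scale_exp _ n)).
Qed.

(** If x I^n were strictly smaller than the intersection of I^(n+1) with (x), that intersection
    would complete a chain of length 2 between x I^n and I^(n+1). *)
Lemma defect1_scale n a : defect n = 1%N ->
    ~ (ideal_exp I n.+1 `<=` gen_ideal [set x]) ->
  ideal_exp I n.+1 (x * a) -> scale x (ideal_exp I n) (x * a).
Proof.
move=> dn nsub Ixa; apply: contrapT => nxa.
have iG := gen_idealP [set x].
have iK := ideal_setI (iE n.+1) iG.
have sK : scale x (ideal_exp I n) `<=` ideal_exp I n.+1 `&` gen_ideal [set x].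
  move=> z xz; split; first exact: scale_exp.
  by case: xz => u _ <-; apply/gen_ideal1P; exists u; rewrite mulrC.
have KI : ideal_exp I n.+1 `&` gen_ideal [set x] `<=` ideal_exp I n.+1 by move=> z [].
have ch1 : chain idfun (ideal_exp I n.+1 `&` gen_ideal [set x]) (scale x (ideal_exp I n)) 1.
  apply: (chain1 (phi := idfun) (isc (iE n)) iK); split=> // sub.
  apply: nxa; apply: sub; split=> //.
  by apply/gen_ideal1P; exists a; rewrite mulrC.
have ch2 : chain idfun (ideal_exp I n.+1) (ideal_exp I n.+1 `&` gen_ideal [set x]) 1.
  apply: (chain1 (phi := idfun) iK (iE n.+1)); split=> // sub.
  by apply: nsub => z /sub[].
have ch := chain_cat ch1 ch2 sK KI.
have := lenle_mlen (phi := idfun) (isc (iE n)) (@scale_exp n) (@flen_scale_exp _ n) ch.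
by rewrite -/(lam _ _) -/(defect n) dn.
Qed.

(* z_i stands for x^(n0+1) (a/x)^i, an element of I^(n0+1); the ascending chain
   condition on the ideals spanned by the z_i makes a/x integral over A, with a
   relation that becomes one of a over I after multiplication by a power of x. *)
Lemma integral_of_mul a : ideal_exp I 2 (x * a) -> integral_over I a.
Proof.
(* Multiplication by a/x preserves I^(n0+1): writing z = xu, the product az = (xa)u lies in
   I^(n0+2), hence in x I^(n0+1). *)
move=> Ixa; have next z : exists w, ideal_exp I n0.+1 z -> ideal_exp I n0.+1 w /\ x * w = a * z.
  have [Iz|nIz] := pselect (ideal_exp I n0.+1 z); last by exists 0.
  have /(reduces_scale (leqnn n0))[u Iu zE] := Iz.
  have /(reduces_scale (leqnSn n0))[w Iw wE] : ideal_exp I n0.+2 (a * z).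
    by rewrite -zE mulrCA mulrA; apply: (ideal_exp_mem (i := 2)).
  by exists w.
have [nx nxP] := choice next; pose z i := iter i nx (x ^+ n0.+1).
have Iz i : ideal_exp I n0.+1 (z i).
  by elim: i => [|i IHi]; [exact: ideal_exp_pow|exact: (proj1 (nxP _ IHi))].
have zS i : x * z i.+1 = a * z i by apply: (proj2 (nxP _ (Iz i))).
have zE i : x ^+ i * z i = a ^+ i * x ^+ n0.+1.
  by elim: i => [//|i IHi]; rewrite exprSr -mulrA zS mulrCA IHi mulrA -exprS.
pose J r := [set w | exists c : nat -> A, w = \sum_(i < r) c i * z i].
have iJ r : ideal (J r).
  split=> [|_ _ [c ->] [c' ->]|b _ [c ->]].
  - by exists (fun=> 0); rewrite big1 // => i _; rewrite mul0r.
  - by exists (fun i => c i + c' i); rewrite -big_split; apply: eq_bigr => i _; rewrite mulrDl.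
  - by exists (fun i => b * c i); rewrite mulr_sumr; apply: eq_bigr => i _; rewrite mulrA.
have [|r Jr] := noetherian_acc noethA iJ.
  move=> r _ [c ->]; exists (fun i => if (i < r)%N then c i else 0).
  rewrite big_ord_recr /= ltnn mul0r addr0; apply: eq_bigr => i _; by rewrite ltn_ord.
have [c zrE] : J r (z r).
  apply: Jr; exists (fun i => (i == r)%:R).
  rewrite big_ord_recr /= eqxx mul1r big1 ?add0r // => i _.
  by rewrite (ltn_eqF (ltn_ord i)) mul0r.
have x_pow_reg k u : x ^+ k * u = 0 -> u = 0.
  by elim: k => [|k IHk]; rewrite ?mul1r // exprS -mulrA => /reduction_regular.
(* An integral equation must have positive degree; r = 0 would make x^(n0+1) zero. *)
have r0 : (0 < r)%N.
  case: r zrE {Jr} => // zE0; rewrite big_ord0 in zE0.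
  have /(x_pow_reg n0.+1) one0 : x ^+ n0.+1 * 1 = 0 by rewrite mulr1.
  by have := oner_neq0 A; rewrite one0 eqxx.
have aE : a ^+ r = \sum_(i < r) c i * x ^+ (r - i) * a ^+ i.
  apply/eqP; rewrite -subr_eq0; apply/eqP; apply: (x_pow_reg n0.+1).
  rewrite mulrBr mulrC -zE zrE !mulr_sumr -sumrB big1 // => i _.
  have -> : x ^+ r = x ^+ (r - i) * x ^+ i by rewrite -exprD subnK // ltnW.
  have := zE i; set p := x ^+ i; set q := x ^+ (r - i); set w := x ^+ n0.+1 => e.
  have -> : q * p * (c i * z i) = q * c i * (p * z i) by ring.
  by rewrite e; ring.
(* The coefficient of a^(r-j) in [aE], moved to the other side; its factor x^j puts it in I^j. *)
exists r, (fun j => - (c (r - j)%N * x ^+ j)); split=> //.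
  move=> i /andP[i1 ir]; have [_ _ IM] := iE i.
  by rewrite -mulNr; apply/IM/ideal_exp_pow.
rewrite aE big_add1 /= big_mkord (reindex_inj rev_ord_inj) /= -big_split big1 //= => i _.
by rewrite -mulNr mulNr mulNr subKn // subrr.
Qed.

(** The cases n = 0, n = 1 and n >= 2 rest on integral closedness, on [defect 2] and on the
    vanishing of the later defects. *)
Lemma scale_exp_regular a n : integrally_closed I -> defect 2 = 1%N ->
    (forall k, (3 <= k)%N -> defect k = 0%N) ->
    ~ (ideal_exp I 3 `<=` gen_ideal [set x]) ->
  ideal_exp I n.+2 (x * a) -> ideal_exp I n.+1 a.
Proof.
move=> icI d2 d3 nsub Ixa.
have cancel k : scale x (ideal_exp I k) (x * a) -> ideal_exp I k a.
  move=> [u Iu /eqP]; rewrite -subr_eq0 -mulrBr => /eqP/reduction_regular/eqP.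
  by rewrite subr_eq0 => /eqP<-.
case: n Ixa => [|[|n]] Ixa.
- by rewrite ideal_exp1 //; apply/icI/integral_of_mul.
- by apply: cancel; apply: defect1_scale.
- by apply: cancel; apply: (defect0_scale (d3 n.+3 isT)).
Qed.

End PrincipalReduction.

(** * Hilbert coefficients *)

Section HilbertCoefficients.
Implicit Types (h : {poly int}).

Lemma hilbert_coefE h i : hilbert_coef h i = \sum_(n < size h) h`_n *+ 'C(n, i).
Proof.
rewrite /hilbert_coef -{1}(coefK h) poly_def raddf_sum /= horner_sum.
apply: eq_bigr => n _.
by rewrite nderivnZ nderivnXn hornerZ hornerMn hornerXn expr1n mulrnAr mulr1.
Qed.

(* With G the partial sums of g, an Abel summation. *)
Lemma sum_binomial2 (g : nat -> int) M :
  \sum_(n < M) g n *+ 'C(n, 2) =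
  \sum_(k < M) (\sum_(n < M) g n - \sum_(n < k.+1) g n) *+ k.
Proof.
elim: M => [|M IHM]; first by rewrite !big_ord0.
rewrite big_ord_recr [RHS]big_ord_recr /= IHM subrr mul0rn addr0.
rewrite -bin2_sum big_mkord.
rewrite -[g M *+ _]mulr_natr natr_sum mulr_sumr -big_split; apply: eq_bigr => k _ /=.
by rewrite mulr_natr -mulrnDl (big_ord_recr M) /= addrAC.
Qed.

(** For n >= 1, C(n,2) - C(n,1) + C(n,0) = C(n-1,2), while the contribution of n = 0 cancels against
    l. *)
Lemma hilbert_coef_relation h (l : int) : h != 0 -> h`_0 = l ->
    hilbert_coef h 2 = hilbert_coef h 1 - hilbert_coef h 0 + l + 1 ->
  \sum_(n < (size h).-1) h`_n.+1 *+ 'C(n, 2) = 1.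
Proof.
move=> h0 <-; rewrite !hilbert_coefE.
case: (size h) (size_poly_eq0 h) => [|M]; first by rewrite (negPf h0).
move=> _ /=; rewrite !big_ord_recl /=.
set s2 := \sum_(i < M) _; set s1 := \sum_(i < M) _; set s0 := \sum_(i < M) _.
rewrite !mulr0n !add0r mulr1n => eq2.
suff: s2 + s0 - s1 = \sum_(n < M) h`_n.+1 *+ 'C(n, 2) by move=> <-; lia.
rewrite /s2 /s1 /s0 -sumrN -!big_split; apply: eq_bigr => n _ /=.
by rewrite /bump /= add1n bin0 bin1 binS bin1 mulrnDr mulr1n [h`_n.+1 *+ n.+1]mulrSr; ring.
Qed.

Import Order.TTheory Num.Theory.

Lemma sumr_term_le (M : nat) (f : nat -> int) i : (i < M)%N -> (forall j, 0 <= f j) ->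
  f i <= \sum_(j < M) f j.
Proof.
by move=> iM f0; rewrite (bigD1 (Ordinal iM)) //= lerDl sumr_ge0.
Qed.

Lemma sum_coef_ge h k : (size h <= k)%N -> \sum_(n < k) h`_n = \sum_(n < size h) h`_n.
Proof.
move=> le_k; rewrite -(subnKC le_k) big_split_ord /= [X in _ + X]big1 ?addr0 // => i _.
by rewrite nth_default // leq_addr.
Qed.

Lemma size4_of_le4 h : h != 0 -> (size h <= 4)%N ->
  \sum_(n < (size h).-1) h`_n.+1 *+ 'C(n, 2) = 1 -> size h = 4%N /\ h`_3 = 1.
Proof.
move=> h0; have := h0; rewrite -size_poly_eq0.
case: (size h) => [//|[|[|[|[|//]]]]] _ _ /=; rewrite ?big_ord_recr big_ord0 //=.
by rewrite !mulr0n !add0r mulr1n.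
Qed.

(** Used in dimension 0. If the size exceeded 4, the top term alone would be a positive integer
    times a binomial coefficient of value at least 3. *)
Lemma size4_nonneg h : h != 0 -> (forall n, 0 <= h`_n) ->
  \sum_(n < (size h).-1) h`_n.+1 *+ 'C(n, 2) = 1 -> size h = 4%N /\ h`_3 = 1.
Proof.
move=> h0 h_ge0 sum1; have [le4|gt4] := leqP (size h) 4; first exact: size4_of_le4.
have := sumr_term_le (f := fun n => h`_n.+1 *+ 'C(n, 2)) (i := (size h).-2) (M := (size h).-1).
rewrite sum1 => le1; have {le1} : h`_(size h).-2.+1 *+ 'C((size h).-2, 2) <= 1.
  by apply: le1 => [|j]; [lia|rewrite mulrn_wge0].
have -> : (size h).-2.+1 = (size h).-1 by lia.
have := h_ge0 (size h).-1; rewrite -lead_coefE; move: h0; rewrite -lead_coef_eq0.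
have : ('C(3, 2) <= 'C((size h).-2, 2))%N by apply: leq_bin2l; lia.
rewrite -mulr_natr natz (_ : 'C(3, 2) = 3%N) //.
by move: (lead_coef h) 'C(_, _) => a b; nia.
Qed.

(** Used in dimension 1, where the coefficients of h may be negative. Abel summation yields
    nonnegative terms [w k *+ k]; for size above 4, the last nonzero one is the leading coefficient
    times at least 2. *)
Lemma size4_partial_sums h : h != 0 ->
    (forall k, \sum_(n < k) h`_n <= \sum_(n < size h) h`_n) ->
  \sum_(n < (size h).-1) h`_n.+1 *+ 'C(n, 2) = 1 -> size h = 4%N /\ h`_3 = 1.
Proof.
move=> h0 h_le sum1; have [le4|gt4] := leqP (size h) 4; first exact: size4_of_le4.
move: sum1; rewrite (sum_binomial2 (fun n => h`_n.+1)).
(* In the application, [w k] is the defect in degree k + 1. *)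
pose w := fun k : nat => \sum_(n < (size h).-1) h`_n.+1 - \sum_(n < k.+1) h`_n.+1.
have w_ge0 k : 0 <= w k.
  rewrite subr_ge0; have := h_le k.+2; case: (size h) gt4 => [//|M] _ /=.
  by rewrite big_ord_recl [X in _ <= X]big_ord_recl lerD2l.
move=> sum1; have := sumr_term_le (f := fun k => w k *+ k) (i := (size h - 3)%N) (M := (size h).-1).
rewrite sum1 => le1; have {le1} : w (size h - 3)%N *+ (size h - 3)%N <= 1.
  by apply: le1 => [|j]; [lia|rewrite mulrn_wge0].
have := w_ge0 (size h - 3)%N; have -> : w (size h - 3)%N = lead_coef h.
  rewrite /w lead_coefE; case: (size h) gt4 => [|[|[|[|M]]]] // _.
  by rewrite !subSS subn0 /= big_ord_recr /= addrAC subrr add0r.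
move: h0; rewrite -lead_coef_eq0 -mulr_natr natz.
have : (2 <= (size h - 3)%N)%N by lia.
by move: (lead_coef h) (size h - 3)%N => a b; nia.
Qed.

End HilbertCoefficients.

Section HilbertPolynomial.
Variables (A : comNzRingType) (I : set A).
Implicit Types (h : {poly int}).

Lemma h_polynomial_neq0 d h : h_polynomial I d h -> h != 0.
Proof. by move=> [h1 _]; apply: contraNneq h1 => ->; rewrite horner0. Qed.

Lemma h_polynomial_coef0 d h : h_polynomial I d h -> h`_0 = (hilbert_fun I 0)%:Z.
Proof.
move=> [_ ->]; rewrite big_ord_recl big_ord0 addr0 /= subn0 -horner_coef0 horner_exp.
by rewrite !hornerE ?oppr0 ?addr0 expr1n mul1r.
Qed.

Lemma h_polynomial_dim0 h n : h_polynomial I 0 h -> h`_n = (hilbert_fun I n)%:Z.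
Proof.
move=> [_ ->]; rewrite big_ord_recl /= expr0 coef1 mul1r subn0 big1 ?addr0 // => i _.
by rewrite coef1 mul0r.
Qed.

(** Division of a power series by 1 - t replaces its coefficients by their partial sums. *)
Lemma h_polynomial_dim1 h n : h_polynomial I 1 h ->
  \sum_(j < n.+1) h`_j = (hilbert_fun I n)%:Z.
Proof.
move=> hI; elim: n => [|n IHn].
  by rewrite big_ord_recl big_ord0 addr0 (h_polynomial_coef0 hI).
have [_ hE] := hI; rewrite big_ord_recr /= IHn hE expr1 !big_ord_recl /= big1 => [|i _].
  by rewrite /bump /= !coefB !coef1 !coefX /= subn0 addn0 subn1 /=; ring.
by rewrite /bump /= coefB coef1 coefX /= subr0 mul0r.
Qed.

Lemma hilbert_fun_bounded h : h_polynomial I 1 h -> exists e, forall n, (hilbert_fun I n <= e)%N.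
Proof.
(* From degree [size h] on the function is constant, so a sum over the earlier degrees and this one
   bounds it. *)
move=> hI; exists (\sum_(i < (size h).+1) hilbert_fun I i)%N => n.
have term i : (i <= size h)%N ->
    (hilbert_fun I i <= \sum_(i < (size h).+1) hilbert_fun I i)%N.
  by rewrite -ltnS => i_lt; rewrite (bigD1 (Ordinal i_lt)) //= leq_addr.
have [/term//|lt_n] := leqP n (size h).
suff -> : hilbert_fun I n = hilbert_fun I (size h) by apply: term.
apply/eqP; rewrite -eqz_nat -!(h_polynomial_dim1 _ hI).
by rewrite (sum_coef_ge (leqnSn _)) sum_coef_ge //; apply: leqW; apply: ltnW.
Qed.

End HilbertPolynomial.

(** * Filtered algebras *)

Section FilteredAlgebra.
Variables (A B : comNzRingType) (phi : {rmorphism A -> B}).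
Variables (F : nat -> set B) (T : B) (e : nat).
(** [F n] models the elements of degree less than n and [T] an element of degree one. [F_T_reg]
    makes multiplication by [T] injective from F(n+1) / F(n) to F(n+2) / F(n+1). *)
Hypotheses (F_submod : forall n, submod phi (F n)) (F0 : forall u, F 0 u -> u = 0).
Hypotheses (FS : forall n, F n `<=` F n.+1) (F_exhaustive : forall u, exists n, F n u).
Hypothesis F_mul : forall i j u v, F i u -> F j v -> F (i + j) (u * v).
Hypothesis F_T : forall n u, F n u -> F n.+1 (T * u).
Hypothesis F_T_reg : forall n u, F n.+1 (T * u) -> F n u.
Hypothesis F_len : forall n, lenle phi (F n.+1) (F n) e.
Implicit Types (Q M : set B) (a b : B) (s : seq B).

Let F_le i j : (i <= j)%N -> F i `<=` F j.
Proof.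
elim: j => [|j IHj]; first by rewrite leqn0 => /eqP-> u.
rewrite leq_eqVlt => /orP[/eqP-> u //|/IHj sub].
exact: (subset_trans sub (@FS j)).
Qed.

Lemma ideal_submod Q : ideal Q -> submod phi Q.
Proof. by move=> [Q0 QD QM]; split=> // a u; apply: QM. Qed.

Let F_lenD n r : lenle phi (F (n + r)) (F n) (r * e).
Proof.
elim: r => [|r IHr]; first by rewrite addn0; apply: lenlexx.
rewrite addnS mulSnr; apply: (lenle_add (K := F (n + r))) => //.
by apply: F_le; apply: leq_addr.
Qed.

Let flen_F n K J : submod phi J -> K `<=` F n -> flen phi K J.
Proof.
move=> [J0 _ _] KF; exists (n * e)%N.
have := @F_lenD 0 n; rewrite add0n; apply: lenle_sub => // u /F0->; exact: J0.
Qed.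

(** Multiplication by [T] injects each graded piece of Q into the next. Their lengths increase and
    are bounded by e, so they become constant and the injections become onto. *)
Lemma filtered_stable Q : ideal Q -> exists N, forall n w, (N <= n)%N ->
  Q w -> F n.+2 w -> exists u, [/\ Q u, F n.+1 u & F n.+1 (w - T * u)].
Proof.
move=> iQ; have sQ := ideal_submod iQ; have [_ _ QM] := iQ.
have sQF n : submod phi (Q `&` F n) := submodI sQ (F_submod n).
have QFS n : Q `&` F n `<=` Q `&` F n.+1 by move=> u [Qu /FS].
have fl n : flen phi (Q `&` F n.+1) (Q `&` F n) by apply: (@flen_F n.+1) => // u [].
pose l n := mlen phi (Q `&` F n.+1) (Q `&` F n).
have TM (a : A) u : T * (phi a * u) = phi a * (T * u) by rewrite mulrCA.
have l_le n : (l n <= e)%N.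
  apply: leq_trans (_ : (mlen phi (F n.+1) (F n) <= e)%N); last exact: mlen_le.
  apply: (mlen_inj_le (f := id)) => // [u []//||u [Qu _] Fu //].
  exact: flen_F (fun u => id).
have TQF n u : (Q `&` F n.+1) u -> (Q `&` F n.+2) (T * u).
  by move=> [Qu Fu]; split; [apply: QM|apply: F_T].
have TJ n u : (Q `&` F n.+1) u -> (Q `&` F n.+1) (T * u) -> (Q `&` F n) u.
  by move=> [Qu _] [_ /F_T_reg].
have l_S n : (l n <= l n.+1)%N.
  apply: (mlen_inj_le (f := fun u => T * u)) => // [u v _ _|u|u];
    [by rewrite mulrDr|exact: TQF|exact: TJ].
(* [N] is the largest length attained and [k] a degree attaining it; the lengths are constant from
   [k] on. *)
have [N [[k lk] maxN]] : exists N, is_max [set j | exists n, l n = j] N.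
  by apply: (is_max_exists (n0 := l 0) (N := e)) => [|_ [n <-]//]; exists 0%N.
have l_mono n : (k <= n)%N -> (l k <= l n)%N.
  elim: n => [|n IHn]; first by rewrite leqn0 => /eqP->.
  rewrite leq_eqVlt => /orP[/eqP-> //|/IHn le]; exact: leq_trans le (l_S n).
exists k => n w kn Qw Fw.
have le : (l n.+1 <= l n)%N.
  apply: leq_trans (l_mono n kn); rewrite lk; apply: maxN; by exists n.+1.
have surj : forall w', (Q `&` F n.+2) w' ->
    exists2 u, (Q `&` F n.+1) u & (Q `&` F n.+1) (w' - T * u).
  apply: (surj_of_mlen (phi := phi) (phi' := phi) (J := Q `&` F n) (f := fun u => T * u)) => //.
  - by move=> u v _ _; rewrite mulrDr.
  - exact: TQF.
  - exact: TJ.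
by have [u [Qu Fu] [_ Fwu]] := surj w (conj Qw Fw); exists u.
Qed.

(** Adjoining an element of Q in F(N) that is not yet generated lowers the bound on the length of
    F(N) modulo the generated part. *)
Lemma filtered_fg Q N : ideal Q ->
  exists2 s : seq B, [set` s] `<=` Q & Q `&` F N `<=` gen_ideal [set` s].
Proof.
move=> iQ; have sG s : submod phi (gen_ideal [set` s] `&` F N).
  by apply: submodI => //; apply/ideal_submod/gen_idealP.
have sub s : gen_ideal [set` s] `&` F N `<=` F N by move=> u [].
suff main : forall k s, [set` s] `<=` Q -> lenle phi (F N) (gen_ideal [set` s] `&` F N) k ->
    exists2 s : seq B, [set` s] `<=` Q & Q `&` F N `<=` gen_ideal [set` s].
  have [k lenk] : flen phi (F N) (gen_ideal [set` [::]] `&` F N).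
    exact: flen_F (fun u => id).
  exact: main lenk.
elim=> [|k IHk] s sQ lenk.
  by exists s => // u [_ Fu]; have [] := lenle0 (sG s) (F_submod N) (sub s) lenk Fu.
have [QG|nQG] := pselect (Q `&` F N `<=` gen_ideal [set` s]); first by exists s.
have [t [[Qt Ft] ngt]] : exists t, (Q `&` F N) t /\ ~ gen_ideal [set` s] t.
  by apply: contrapT => nE; apply: nQG => u Qu; apply: contrapT => ngu; apply: nE; exists u.
apply: (IHk (t :: s)).
  by move=> u; rewrite /= inE => /orP[/eqP->|/sQ].
apply: (lenle_step (sG s) (sG (t :: s))) => //; split.
  by move=> u [gu Fu]; split=> //; apply: gen_ideal_behead.
by move=> gsub; apply: ngt; have [] := gsub t (conj (@gen_ideal_head _ t s) Ft).
Qed.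

(** Generators for the elements of Q of low degree suffice: in higher degree, subtracting a
    [T]-multiple of an element of Q lowers the degree. *)
Lemma filtered_noetherian : noetherian B.
Proof.
move=> Q iQ; have [N stab] := filtered_stable iQ.
have [s sQ Qs] := filtered_fg N.+1 iQ; exists s.
have [g0 gD gM] := gen_idealP [set` s].
apply/seteqP; split; last exact: gen_ideal_sub.
move=> u Qu; have [n Fu] := F_exhaustive u.
elim: n u Qu Fu => [|n IHn] u Qu Fu; first by rewrite (F0 Fu).
have [le|lt] := leqP n.+1 N.+1; first by apply: Qs; split=> //; apply: F_le Fu.
case: n lt IHn Fu => [//|n] lt IHn Fu.
have [w [Qw Fw Fuw]] := stab n u lt Qu Fu.
have -> : u = u - T * w + T * w by rewrite subrK.
have QTw : Q (T * w) by case: iQ => _ _; apply.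
by apply: gD; [exact: (IHn _ (ideal_sub iQ Qu QTw) Fuw)|exact: (gM _ _ (IHn w Qw Fw))].
Qed.

(* Multiplication by a, of filtration degree r, embeds F N / Q into
   F (N + r) / Q, whose length is larger by at most r * e. *)
Lemma filtered_colength Q a : ideal Q -> (forall u, Q (a * u) -> Q u) ->
  flen phi setT (sumset Q (gen_ideal [set a])).
Proof.
move=> iQ aQ; have [r Fa] := F_exhaustive a; exists (r * e)%N.
have sQ := ideal_submod iQ; have [Q0 QD QM] := iQ.
set Q' := sumset _ _; have iQ' : ideal Q' := ideal_sumset iQ (gen_idealP _).
have sQ' := ideal_submod iQ'.
have sQF n : submod phi (Q `&` F n) := submodI sQ (F_submod n).
have QF n : Q `&` F n `<=` F n by move=> u [].
have Q'F n : Q' `&` F n `<=` F n by move=> u [].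
have len N : lenle phi (F (N + r)) (Q' `&` F (N + r)) (r * e).
  set K' := F (N + r); set J' := Q `&` K'.
  have sK' : submod phi K' := F_submod _.
  have sJ' : submod phi J' := sQF _.
  have fl K J : submod phi J -> K `<=` K' -> flen phi K J by apply: flen_F.
  have aF u : F N u -> K' (a * u) by move=> Fu; rewrite /K' addnC; apply: F_mul.
  set Im := sumset ((fun u => a * u) @` F N) J'.
  have sI : submod phi ((fun u => a * u) @` F N).
    apply: (submod_image (phi := phi) (K := F N)) => // [u v _ _|b u _].
      by rewrite mulrDr.
    by rewrite mulrCA.
  have sIm : submod phi Im := submod_sumset sI sJ'.
  have J'Im : J' `<=` Im := sumsetr sI.
  have ImK' : Im `<=` K' by apply: (sumset_sub sK') => [_ [u Fu <-]|u []//]; apply: aF.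
  have le1 : (mlen phi (F N) (Q `&` F N) <= mlen phi Im J')%N.
    apply: (mlen_inj (K' := K') (f := fun u => a * u)) => //.
    - by move=> u [].
    - by move=> u v _ _; rewrite mulrDr.
    - by move=> b u _; rewrite mulrCA.
    - exact: fl.
    - by move=> u Fu [Qau _]; split=> //; apply: aQ.
  set L := sumset (F N) J'.
  have sL : submod phi L := submod_sumset (F_submod N) sJ'.
  have J'L : J' `<=` L := sumsetr (F_submod N).
  have FL : F N `<=` L := sumsetl sJ'.
  have FK' : F N `<=` K' by apply: F_le; apply: leq_addr.
  have LK' : L `<=` K' by apply: (sumset_sub sK') => // u [].
  have le2 : (mlen phi L J' <= mlen phi (F N) (Q `&` F N))%N.
    apply: (mlen_surj_le (f := id)) => //.
    - by apply: (@flen_F N).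
    - by move=> u [Qu /FK' K'u].
    - move=> _ [u [v [Fu Jv ->]]]; exists u => //.
      by rewrite addrC addKr.
  have le3 : (mlen phi K' L <= r * e)%N.
    by apply: mlen_le => //; apply: lenle_sub (@F_lenD N r).
  (* [Im / J'] is at least as long as [L / J'] by [le1] and [le2], so [K' / Im] is at most as long
     as [K' / L]. *)
  have : (mlen phi K' Im <= r * e)%N.
    have := mlen_add sJ' sIm sK' J'Im ImK' (fl _ _ sJ' (fun u => id)).
    rewrite (mlen_add sJ' sL sK' J'L LK' (fl _ _ sJ' (fun u => id))).
    by move: le1 le2 le3; lia.
  move=> le4; apply: (lenle_sub (K := K') (J := Im)) => //.
    apply: (sumset_sub (submodI sQ' sK')) => [_ [u Fu <-]|u [Qu K'u]]; split=> //.
    - apply: (sumsetr sQ); apply/gen_ideal1P; exists u; by rewrite mulrC.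
    - exact: aF.
    - by apply: (sumsetl (phi := phi)) => //; apply/ideal_submod/gen_idealP.
  by apply: lenleW le4 _; apply: lenle_mlen => //; apply: fl.
move=> k [C Cb Cs].
(* A chain of length k is strict because of k elements; they lie in a common F(N), so intersecting
   with F(N+r) keeps it strict. *)
have wit i : exists p : B * nat, (i < k)%N -> [/\ C i.+1 p.1, ~ C i p.1 & F p.2 p.1].
  have [ik|nik] := boolP (i < k)%N; last by exists (0, 0%N).
  have [_ nC] := Cs i ik.
  have [u [Cu nCu]] : exists u, C i.+1 u /\ ~ C i u.
    by apply: contrapT => nE; apply: nC => u Cu; apply: contrapT => nCu; apply: nE; exists u.
  by have [n Fu] := F_exhaustive u; exists (u, n).
have [p pP] := choice wit; pose N := \max_(i < k) (p i).2.
apply: (len N); exists (fun i => C i `&` F (N + r)) => i ik.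
  have [sC Q'C _] := Cb i ik; split; [exact: submodI|by move=> u [/Q'C]|by move=> u []].
have [CC _] := Cs i ik; split; first by move=> u [/CC].
have [Cp nCp Fp] := pP i ik; move=> sub; apply: nCp.
apply: (proj1 (sub _ _)); split=> //; apply: F_le Fp; apply: leq_trans (leq_addr _ _).
exact: (leq_bigmax (Ordinal ik)).
Qed.

(** An injective endomorphism of a module of finite length is onto: once Q + (b^i) is stationary,
    b^i (1 - gb) lies in Q for some g, hence so does 1 - gb. *)
Lemma finite_colength_regular Q b : ideal Q -> flen phi setT Q ->
  (forall u, Q (b * u) -> Q u) -> sumset Q (gen_ideal [set b]) 1.
Proof.
move=> iQ fl bQ; have iD i := ideal_sumset iQ (gen_idealP [set b ^+ i]).
have [||i Di] := flen_desc (D := fun i => sumset Q (gen_ideal [set b ^+ i])) fl.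
- move=> i; split=> //; first exact: ideal_submod.
  exact: (sumsetl (phi := idfun) (gen_idealP _)).
- move=> i _ [q [_ [Qq /gen_ideal1P[g ->] ->]]].
  exists q, (g * b ^+ i.+1); split=> //.
  by apply/gen_ideal1P; exists (g * b); rewrite exprS mulrA.
have [|q [_ [Qq /gen_ideal1P[g ->] bE]]] := Di (b ^+ i).
  exact: (sumsetr (phi := idfun) iQ) (mem_gen_ideal _).
have : Q (b ^+ i * (1 - g * b)).
  have -> : b ^+ i * (1 - g * b) = q; last by [].
  by rewrite mulrBr mulr1 {1}bE exprS; ring.
have bQi j u : Q (b ^+ j * u) -> Q u.
  by elim: j => [|j IHj]; rewrite ?mul1r // exprS -mulrA => /bQ.
move/bQi => Q1; exists (1 - g * b), (g * b); rewrite subrK; split=> //.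
by apply/gen_ideal1P; exists g.
Qed.

(** The common core of the bounds on prime chains and on regular sequences: B / (Q + (a)) has finite
    length, hence so has B / Q', on which b is injective. *)
Lemma filtered_dim_le1 Q Q' a b : ideal Q -> ideal Q' -> Q `<=` Q' -> Q' a ->
  (forall u, Q (a * u) -> Q u) -> (forall u, Q' (b * u) -> Q' u) ->
  sumset Q' (gen_ideal [set b]) 1.
Proof.
move=> iQ iQ' QQ' Q'a aQ bQ'; apply: finite_colength_regular => //.
apply: flen_sub (filtered_colength iQ aQ) => //.
apply: (sumset_sub (phi := idfun)) => // _ /gen_ideal1P[r ->].
by case: iQ' => _ _; apply.
Qed.

Lemma prime_regular Q a : prime_ideal Q -> ~ Q a -> forall u, Q (a * u) -> Q u.
Proof. by move=> [_ _ Qpr] nQa u /Qpr[]. Qed.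

Lemma proper_witness (Q Q' : set B) : Q `<` Q' -> exists u, Q' u /\ ~ Q u.
Proof.
move=> [_ nsub]; apply: contrapT => nE; apply: nsub => u Q'u.
by apply: contrapT => nQu; apply: nE; exists u.
Qed.

Lemma filtered_prime_chain n (P : nat -> set B) : prime_chain n P -> (n <= 1)%N.
Proof.
move=> [pP sP]; rewrite leqNgt; apply/negP => n2.
have [[i0 _ _] [i1 _ _]] := (pP 0%N (leq0n n), pP 1%N (ltnW n2)).
have [iP2 n1 _] := pP 2%N n2; apply: n1.
have [a [P1a nP0a]] := proper_witness (sP 0%N (ltnW n2)).
have [b [P2b nP1b]] := proper_witness (sP 1%N n2).
have : sumset (P 1%N) (gen_ideal [set b]) 1.
  apply: (filtered_dim_le1 i0 i1 _ P1a).
  - by case: (sP 0%N (ltnW n2)).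
  - exact: prime_regular (pP 0%N _) nP0a.
  - exact: prime_regular (pP 1%N (ltnW n2)) nP1b.
apply: (sumset_sub (phi := idfun)) => //; first by case: (sP 1%N n2).
by move=> _ /gen_ideal1P[r ->]; case: iP2 => _ _; apply.
Qed.

Lemma filtered_regular_seq M s : ideal M -> ~ M 1 -> regular_seq s ->
  [set` s] `<=` M -> (size s <= 1)%N.
Proof.
move=> iM nM1 [_ sreg] sM; case: s sreg sM => [|a [|b s]] // sreg sM; case: nM1.
have Ma : M a by apply: sM; rewrite /= inE eqxx.
have Mb : M b by apply: sM; rewrite /= !inE eqxx orbT.
have : sumset (gen_ideal [set` [:: a]]) (gen_ideal [set b]) 1.
  apply: (filtered_dim_le1 (Q := gen_ideal [set` [::]]) (a := a)).
  - exact: gen_idealP.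
  - exact: gen_idealP.
  - exact: gen_ideal_behead.
  - exact: gen_ideal_head.
  - exact: (sreg 0%N isT).
  - exact: (sreg 1%N isT).
apply: (sumset_sub (phi := idfun)) => //.
  by apply: gen_ideal_sub => // u; rewrite /= inE => /eqP->.
by move=> _ /gen_ideal1P[r ->]; case: iM => _ _; apply.
Qed.

Let F_T_reg_iter k n u : F (k + n) (T ^+ k * u) -> F n u.
Proof.
elim: k n => [|k IHk] n; first by rewrite mul1r.
by rewrite exprS -mulrA => /F_T_reg/IHk.
Qed.

Let F_T_iter k n u : F n u -> F (k + n) (T ^+ k * u).
Proof.
by move=> Fu; elim: k => [|k IHk]; rewrite ?mul1r // exprS -mulrA; apply: F_T.
Qed.

(** If T^j u = p(T) u with u in F(n+1), the right side lies in F(j+n), so u lies in F(n); descending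
    to F(0) gives u = 0. *)
Lemma monic_regular (j : nat) (p : {poly A}) u : (0 < j)%N -> (size p <= j)%N ->
  (T ^+ j - (map_poly phi p).[T]) * u = 0 -> u = 0.
Proof.
case: j => // j _ pj /eqP; rewrite mulrBl subr_eq0 => /eqP Tu.
have [n Fu] := F_exhaustive u; elim: n Fu => [/F0//|n IHn] Fu; apply: IHn.
apply: (@F_T_reg_iter j.+1); rewrite Tu.
rewrite (@horner_coef_wide _ j.+1) ?mulr_suml; last first.
  exact: leq_trans (size_poly _ _) pj.
have [_ _ FZ] := F_submod (j.+1 + n).
apply: (submod_sum (F_submod _)) => i; rewrite coef_map -mulrA; apply: FZ.
apply: F_le (F_T_iter i Fu); rewrite addSnnS leq_add2r.
by rewrite -ltnS.
Qed.

(** If T is outside M, some g inverts it modulo M. Then B / M has finite length over A, so the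
    powers of T are dependent modulo M and M contains a monic polynomial in T. *)
Lemma maximal_regular M : maximal_ideal M -> exists2 f, M f & forall u, f * u = 0 -> u = 0.
Proof.
move=> maxM; have [iM nM1 _] := maxM; have [M0 MD MM] := iM.
have [_ _ Mprime] := maximal_prime maxM; have sM := ideal_submod iM.
have [MT|nMT] := pselect (M T).
  exists T => // u Tu; apply: F0; apply: F_T_reg; rewrite Tu.
  by case: (F_submod 1).
have [g MgT] := maximal_coprime maxM nMT.
have nMg : ~ M g.
  by move=> Mg; apply: nM1; rewrite -(subrK (g * T) 1); apply: MD => //; rewrite mulrC; apply: MM.
have [n0 stab] := filtered_stable (ideal_setT B).
have [r Fg] := F_exhaustive g.
(* In every degree, an element is a multiple of T up to a term of bounded degree. *)
have dec k w : F (n0.+1 + k) w ->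
    exists w0 w', [/\ F n0.+1 w0, F (n0 + k) w' & w = w0 + T * w'].
  elim: k w => [|k IHk] w Fw.
    exists w, 0; rewrite addn0 in Fw; split=> //; first by case: (F_submod (n0 + 0)).
    by rewrite mulr0 addr0.
  rewrite addSnnS !addnS in Fw.
  have [u [_ Fu /= Fwu]] := stab _ w (leq_addr k n0) I Fw.
  have [w0 [w' [Fw0 Fw' E]]] := IHk (w - T * u) Fwu.
  exists w0, (w' + u); split=> //; last by rewrite mulrDr addrA -E subrK.
  by rewrite addnS; case: (F_submod (n0 + k).+1) => _ FD _; apply: FD => //; apply: FS.
(* [V] is stable under g: in a decomposition w0 + T w', the term g w0 has degree within [N], and g T
   w' is w' modulo M. *)
pose N := (n0.+1 + r)%N; pose V := sumset (F N) M.
have sV : submod phi V := submod_sumset (F_submod N) sM.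
have [V0 VD VM] := sV.
have MV : M `<=` V := sumsetr (F_submod N).
have FV : F N `<=` V := sumsetl sM.
have gV w : V w -> V (g * w).
  move=> [w1 [m1 [/dec[w0 [w' [Fw0 Fw' ->]]] Mm1 ->]]].
  have -> : g * (w0 + T * w' + m1) = (w0 * g) + (w' + (g * m1 - w' * (1 - g * T))) by ring.
  apply: (VD); first by apply: FV; apply: F_mul.
  exists w', (g * m1 - w' * (1 - g * T)); split=> //.
    by apply: F_le Fw'; rewrite /N addSn.
  by apply: ideal_sub => //; apply: MM.
have flV : flen phi V M.
  have [k lenk] := @flen_F N (F N) (F 0) (F_submod 0) (fun u => id).
  exists k; apply: (lenle_surj (K := F N) (J := F 0) (f := id)) lenk => //.
  - exact: F_le.
  - by move=> u /F0->.
  - by move=> _ [u [v [Fu Mv ->]]]; exists u => //; rewrite addrC addKr.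
(* Multiplication by g is injective on V / M, which has finite length; stationarity of the g^i V + M
   makes it onto. *)
pose D i := sumset ((fun u => g ^+ i * u) @` V) M.
have sD0 i : submod phi ((fun u => g ^+ i * u) @` V).
  apply: (submod_image (phi := phi) (K := V)) => // [u v _ _|b u _].
    by rewrite mulrDr.
  by rewrite mulrCA.
have [||i Di] := flen_desc (D := D) flV.
- move=> i; split; [exact: submod_sumset|exact: sumsetr|].
  apply: (sumset_sub sV) => // _ [u Vu <-].
  by elim: i => [|i IHi]; rewrite ?mul1r // exprS -mulrA; apply: gV.
- move=> i _ [_ [v [[u Vu <-] Mv ->]]]; exists (g ^+ i.+1 * u), v; split=> //.
  by exists (g * u); [apply: gV|rewrite exprSr mulrA].
have VgV w : V w -> exists2 w', V w' & M (w - g * w').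
  move=> Vw; have [|_ [v [[w' Vw' <-] Mv E]]] := Di (g ^+ i * w).
    by apply: (sumsetl sM); exists w.
  exists w' => //.
  have : M (g ^+ i * (w - g * w')).
    by rewrite mulrBr E mulrA -exprSr addrC addKr.
  elim: (i) => [|l IHl]; first by rewrite mul1r.
  by rewrite exprS -mulrA => /Mprime[].
(* If w is g w' modulo M, then T w is w' modulo M. *)
have TV w : V w -> V (T * w).
  move=> /VgV[w' Vw' Mw].
  have -> : T * w = w' + (T * (w - g * w') + - w' * (1 - g * T)) by ring.
  by apply: (VD) => //; apply: MV; apply: MD; apply: MM.
(* Above degree [N], an element is T u plus a term of lower degree, so stability under T gives all
   of B. *)
have VT w : V w.
  have [n Fw] := F_exhaustive w.
  elim: n w Fw => [|n IHn] w Fw; first by rewrite (F0 Fw).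
  have [le|lt] := leqP n.+1 N; first by apply: FV; apply: F_le Fw.
  case: n lt IHn Fw => [//|n] lt IHn Fw.
  have [|u [_ Fu Fwu]] := stab n w _ I Fw.
    by move: lt; rewrite /N; lia.
  by rewrite -(subrK (T * u) w); apply: (VD); [apply: IHn|apply/TV/IHn].
have flM : flen phi setT M by apply: flen_sub flV.
(* Modulo M, these are the polynomials in T of size at most j; stationarity at j expresses T^j by
   lower powers. *)
pose U j := [set u | exists2 p : {poly A}, (size p <= j)%N & M (u - (map_poly phi p).[T])].
have [||j Uj] := flen_asc (D := U) flM.
- move=> j; split=> //; last first.
    by move=> u Mu; exists 0; rewrite ?size_poly0 // rmorph0 horner0 subr0.
  split; first by exists 0; rewrite ?size_poly0 // rmorph0 horner0 subr0.
  + move=> u v [p pj Mu] [q qj Mv]; exists (p + q).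
      by apply: leq_trans (size_polyD _ _) _; rewrite geq_max pj.
    by rewrite rmorphD hornerD opprD addrACA; apply: MD.
  + move=> a u [p pj Mu]; exists (a *: p); first exact: leq_trans (size_scale_leq _ _) pj.
    by rewrite map_polyZ hornerZ -mulrBr; apply: MM.
- by move=> j u [p pj Mu]; exists p => //; apply: leqW.
have [|p pj Mf] := Uj (T ^+ j).
  by exists 'X^j; rewrite ?size_polyXn // map_polyXn hornerXn subrr.
exists (T ^+ j - (map_poly phi p).[T]) => // u.
(* Stationarity at j = 0 would put 1 in M. *)
apply: monic_regular => //; case: j pj Mf {Uj} => // p0 M1; case: nM1.
move: p0 M1; rewrite leqn0 size_poly_eq0 => /eqP->.
by rewrite rmorph0 horner0 subr0.
Qed.

(** The products of a power of f with an element outside M form a multiplicative set without 0,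
    since f is regular. A prime avoiding it lies in M and misses f. *)
Lemma prime_below_regular M f : maximal_ideal M -> M f -> (forall u, f * u = 0 -> u = 0) ->
  exists2 P, prime_ideal P & P `<` M.
Proof.
move=> maxM Mf f_reg; have [iM nM1 _] := maxM; have [_ _ Mprime] := maximal_prime maxM.
have i0 : ideal [set 0 : B].
  by split=> // [u v /= -> ->|a u /= ->]; rewrite ?addr0 ?mulr0.
pose S := [set w | exists i (t : B), ~ M t /\ w = f ^+ i * t].
have [||_ -> [i [s [nMs E]]]|P [pP _ PS]] := @exists_prime_ideal _ [set 0] S i0.
- by exists 0%N, 1; rewrite mulr1.
- move=> _ _ [i [s [nMs ->]]] [j [t [nMt ->]]]; exists (i + j)%N, (s * t).
  by rewrite exprD mulrACA; split=> // /Mprime[].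
- apply: nMs; have -> : s = 0; last by case: iM.
  by elim: i E => [|i IHi]; rewrite ?mul1r // exprS -mulrA => /esym/f_reg/esym.
exists P => //; split=> [a Pa|sub].
  by apply: contrapT => nMa; apply: (PS a Pa); exists 0%N, a; rewrite mul1r.
by apply: (PS f (sub f Mf)); exists 1%N, 1; rewrite mulr1.
Qed.

Lemma filtered_cohen_macaulay : cohen_macaulay B.
Proof.
split=> [|M maxM]; first exact: filtered_noetherian.
have [iM nM1 _] := maxM; have [f Mf f_reg] := maximal_regular maxM.
have gM : gen_ideal [set` [:: f]] `<=` M.
  by apply: gen_ideal_sub => // u; rewrite /= inE => /eqP->.
exists 1%N; split; split.
- exists [:: f]; split=> //; last by move=> u; rewrite /= inE => /eqP->.
  split=> [/gM//|[|//] _ u /= /gen_ideal_nil/f_reg->].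
  by case: (gen_idealP [set` Nil B]).
- by move=> k [s [<- sreg sM]]; apply: filtered_regular_seq sM.
- have [P pP PM] := prime_below_regular maxM Mf f_reg.
  exists (fun i => if i is 0 then P else M); split=> //; split=> [[|i] _|[|//] _] //.
  exact: maximal_prime.
- by move=> k [P [cP _]]; apply: filtered_prime_chain cP.
Qed.

End FilteredAlgebra.

(** * The associated graded ring *)

Section AssociatedGraded.
Variables (A : comNzRingType) (I : idealr A).

Local Open Scope quotient_scope.
Local Notation IA := [set` I].
Local Notation Q := {ideal_quot (@gr_kernel A I : idealr _)}.
Implicit Types (p q : rees_algebra I) (a b x : A).

Definition gr_pi p : assoc_graded I := \pi_Q p.

Lemma reesP (r : {poly A}) : reflect (forall n, ideal_exp IA n r`_n) (r \in rees I).
Proof. exact: asboolP. Qed.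

Lemma gr_piP p q : gr_pi p = gr_pi q <-> forall n, ideal_exp IA n.+1 (rees_val p - rees_val q)`_n.
Proof.
split=> [/eqP E|E]; last apply/eqP.
  by move: E; rewrite /gr_pi -Quotient.idealrBE => /asboolP.
by rewrite /gr_pi -Quotient.idealrBE; apply/asboolP.
Qed.

Lemma gr_piD p q : gr_pi (p + q) = gr_pi p + gr_pi q.
Proof. exact: (rmorphD \pi_Q). Qed.

Lemma gr_piB p q : gr_pi (p - q) = gr_pi p - gr_pi q.
Proof. exact: (rmorphB \pi_Q). Qed.

Lemma gr_piM p q : gr_pi (p * q) = gr_pi p * gr_pi q.
Proof. exact: (rmorphM \pi_Q). Qed.

Lemma gr_pi1 : gr_pi 1 = 1.
Proof. exact: (rmorph1 \pi_Q). Qed.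

Lemma gr_pi0 : gr_pi 0 = 0.
Proof. exact: (rmorph0 \pi_Q). Qed.

Lemma polyC_rees a : a%:P \in rees I.
Proof.
apply/reesP => n; rewrite coefC; case: n => [//|n] /=.
by case: (ideal_expP IA n.+1).
Qed.

Definition gr_const a : assoc_graded I := gr_pi (ReesElement (polyC_rees a)).

Lemma gr_const_is_zmod_morphism : zmod_morphism gr_const.
Proof.
move=> a b; rewrite /gr_const -gr_piB; congr gr_pi; apply: val_inj.
by rewrite /= polyCB.
Qed.

Lemma gr_const_is_monoid_morphism : monoid_morphism gr_const.
Proof.
split=> [|a b]; first by rewrite -gr_pi1; congr gr_pi; apply: val_inj.
by rewrite /gr_const -gr_piM; congr gr_pi; apply: val_inj; rewrite /= polyCM.
Qed.

HB.instance Definition _ :=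
  GRing.isZmodMorphism.Build A (assoc_graded I) gr_const gr_const_is_zmod_morphism.
HB.instance Definition _ :=
  GRing.isMonoidMorphism.Build A (assoc_graded I) gr_const gr_const_is_monoid_morphism.

(* The elements of degree less than n. *)
Definition gr_filt n : set (assoc_graded I) :=
  [set g | exists2 p, (size (rees_val p) <= n)%N & g = gr_pi p].

Lemma gr_filt_submod n : submod gr_const (gr_filt n).
Proof.
split=> [|_ _ [p pn ->] [q qn ->]|a _ [p pn ->]].
- by exists 0; rewrite ?gr_pi0 // size_poly0.
- exists (p + q); rewrite ?gr_piD //.
  by apply: leq_trans (size_polyD _ _) _; rewrite geq_max pn.
- exists (ReesElement (polyC_rees a) * p); rewrite ?gr_piM //=.
  by rewrite mul_polyC; apply: leq_trans (size_scale_leq _ _) pn.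
Qed.

Lemma gr_filt0 g : gr_filt 0 g -> g = 0.
Proof.
move=> [p]; rewrite leqn0 size_poly_eq0 => /eqP p0 ->; rewrite -gr_pi0.
by congr gr_pi; apply: val_inj.
Qed.

Lemma gr_filtS n : gr_filt n `<=` gr_filt n.+1.
Proof. by move=> _ [p pn ->]; exists p => //; apply: leqW. Qed.

Lemma gr_pi_surj g : exists p, g = gr_pi p.
Proof. by exists (repr (g : Q)); rewrite /gr_pi reprK. Qed.

Lemma gr_filt_exhaustive g : exists n, gr_filt n g.
Proof. by have [p ->] := gr_pi_surj g; exists (size (rees_val p)), p. Qed.

Lemma gr_filt_mul i j g g' : gr_filt i g -> gr_filt j g' -> gr_filt (i + j) (g * g').
Proof.
move=> [p pi ->] [q qj ->]; exists (p * q); rewrite ?gr_piM //.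
apply: leq_trans (size_polyMleq _ _) _; apply: leq_trans (leq_pred _) _.
exact: leq_add.
Qed.

Lemma monom_rees a n : ideal_exp IA n a -> a *: 'X^n \in rees I.
Proof.
move=> Ia; apply/reesP => k; rewrite coefZ coefXn.
case: eqP => [->|_]; first by rewrite mulr1.
by rewrite mulr0; case: (ideal_expP IA k).
Qed.

(** The class of a t^n when a is in I^n; [insubd] supplies 0 when a t^n is not in the Rees
    algebra. *)
Definition gr_monom n a : assoc_graded I := gr_pi (insubd 0 (a *: 'X^n)).

Lemma val_monom n a : ideal_exp IA n a ->
  rees_val (insubd (0 : rees_algebra I) (a *: 'X^n)) = a *: 'X^n.
Proof. by move=> Ia; apply: (insubdK (0 : rees_algebra I)); apply: monom_rees. Qed.

(** The map from I^n / I^(n+1) to F(n+1) / F(n) sending a to the class of a t^n is onto. *)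
Lemma gr_filt_len n e : lenle idfun (ideal_exp IA n) (ideal_exp IA n.+1) e ->
  lenle gr_const (gr_filt n.+1) (gr_filt n) e.
Proof.
have iE k := ideal_expP IA k; have [n0 nD nM] := iE n.
apply: (lenle_surj (phi := idfun) (phi' := gr_const) (f := gr_monom n)) => //.
- exact: ideal_expS_sub.
- move=> u v Iu Iv; rewrite /gr_monom -gr_piD; congr gr_pi; apply: val_inj.
  by rewrite /= !val_monom ?scalerDl //; apply: nD.
- move=> a u Iu; rewrite /gr_monom -gr_piM; congr gr_pi; apply: val_inj.
  by rewrite /= !val_monom ?mul_polyC ?scalerA //; apply: nM.
- move=> u Iu; exists 0; first by rewrite size_poly0.
  apply/gr_piP => k; rewrite val_monom; last exact: ideal_expS_sub.
  rewrite subr0 coefZ coefXn; case: eqP => [->|_]; first by rewrite mulr1.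
  by rewrite mulr0; case: (iE k.+1).
- move=> _ [p pn ->]; have /reesP Ip := rees_valP p.
  exists ((rees_val p)`_n) => //; rewrite /gr_monom -gr_piB.
  eexists; last by [].
  rewrite /= val_monom //; apply/leq_sizeP => k nk; rewrite coefB coefZ coefXn.
  move: nk; rewrite leq_eqVlt => /orP[/eqP->|nk]; first by rewrite eqxx mulr1 subrr.
  by rewrite gtn_eqF // mulr0 subr0 (leq_sizeP _ _ pn).
Qed.

Lemma gr_filt_shift x n g : IA x -> gr_filt n g -> gr_filt n.+1 (gr_monom 1 x * g).
Proof.
move=> Ix [p pn ->]; exists (insubd 0 (x *: 'X^1) * p); last by rewrite gr_piM.
rewrite /= val_monom ?ideal_exp1 //; last exact: idealr_ideal.
rewrite -scalerAl mulrC; apply: leq_trans (size_scale_leq _ _) _.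
by apply: leq_trans (size_polyMleq _ _) _; rewrite size_polyXn addn2.
Qed.

Lemma gr_filt_shift_regular x n g : IA x ->
    (forall k a, ideal_exp IA k.+2 (x * a) -> ideal_exp IA k.+1 a) ->
  gr_filt n.+1 (gr_monom 1 x * g) -> gr_filt n g.
Proof.
move=> Ix x_reg; have [p ->] := gr_pi_surj g.
rewrite /gr_monom -gr_piM => -[q qn /gr_piP E]; have /reesP Ip := rees_valP p.
(* In degree k + 1 > n the polynomial [q] vanishes, so x times the k-th coefficient of [p] lies in
   I^(k+2). *)
have E' k : (n <= k)%N -> ideal_exp IA k.+1 (rees_val p)`_k.
  move=> nk; apply: x_reg; have := E k.+1.
  rewrite /= val_monom ?ideal_exp1 //; last exact: idealr_ideal.
  rewrite coefB (leq_sizeP _ _ qn) ?ltnS // subr0 -scalerAl coefZ expr1.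
  by rewrite coefXM.
(* [p] itself may be too long; by [E'] its truncation represents the same class. *)
have tP : take_poly n (rees_val p) \in rees I.
  apply/reesP => k; rewrite coef_take_poly; case: ifP => // _.
  by case: (ideal_expP IA k).
exists (ReesElement tP); first exact: size_take_poly.
apply/gr_piP => k /=; rewrite coefB coef_take_poly.
case: ltnP => kn; last by rewrite subr0; apply: E'.
by rewrite subrr; case: (ideal_expP IA k.+1).
Qed.

Lemma assoc_graded_cohen_macaulay x e : IA x ->
    (forall k a, ideal_exp IA k.+2 (x * a) -> ideal_exp IA k.+1 a) ->
    (forall n, lenle idfun (ideal_exp IA n) (ideal_exp IA n.+1) e) ->
  cohen_macaulay (assoc_graded I).
Proof.
move=> Ix x_reg len.
apply: (@filtered_cohen_macaulay A (assoc_graded I) gr_const gr_filt (gr_monom 1 x) e).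
- exact: gr_filt_submod.
- exact: gr_filt0.
- exact: gr_filtS.
- exact: gr_filt_exhaustive.
- exact: gr_filt_mul.
- by move=> n u; apply: gr_filt_shift.
- by move=> n u; apply: gr_filt_shift_regular.
- by move=> n; apply: gr_filt_len.
Qed.

End AssociatedGraded.

(** * Derivation of the two claims *)

Lemma infinite_residue_field (A : comNzRingType) (m : idealr A) :
    infinite_set [set: {ideal_quot m}] ->
  exists c : nat -> A, forall i j, i != j -> ~ [set` m] (c i - c j).
Proof.
move=> /infiniteP/card_leP[f].
exists (fun i => repr (val (f (to_setT i)) : {ideal_quot m})) => i j ij /=.
rewrite Quotient.idealrBE !reprK => /eqP/val_inj fij.
have /(congr1 val) /= E : to_setT i = to_setT j by apply: (@inj _ _ _ f); rewrite ?inE.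
by rewrite E eqxx in ij.
Qed.

Section HilbertReduction.
Variables (A : comNzRingType) (m I : set A) (x y : A) (n0 : nat) (h : {poly int}).
Hypotheses (mloc : local_ring m) (noethA : noetherian A) (primI : primary_to m I).
Hypotheses (Ix : I x) (my : m y) (y_reg : forall u, y * u = 0 -> u = 0).
Hypothesis red : forall n, (n0 <= n)%N -> reduces I [:: x] n.
Hypothesis hI : h_polynomial I 1 h.

(** The left side is the length of A / xA for every n; for large n the defect is 0 and the partial
    sum is complete. *)
Lemma hilbert_sum_defect n :
  \sum_(j < n.+1) h`_j + (defect I x n)%:Z = \sum_(j < size h) h`_j.
Proof.
have key k := hilbert_fun_defect mloc noethA primI Ix my y_reg red k.
pose N := maxn n0 (size h).
rewrite -(@sum_coef_ge h N.+1); last by apply: leqW; apply: leq_maxr.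
rewrite !(h_polynomial_dim1 _ hI) -PoszD key -(key N).
by rewrite (defect0 (n0 := n0)) ?addn0 // leq_maxl.
Qed.

Lemma partial_sums_le k : \sum_(n < k) h`_n <= \sum_(n < size h) h`_n.
Proof.
case: k => [|k]; last by rewrite -(hilbert_sum_defect k) Num.Theory.lerDl.
(* The empty sum is bounded because the total is a Hilbert function value plus a defect. *)
by rewrite big_ord0 -(hilbert_sum_defect 0) (h_polynomial_dim1 _ hI) -PoszD.
Qed.

(** The partial sum up to degree 2 misses only h_3, and those from degree 3 on miss nothing. *)
Lemma defect_size4 : size h = 4%N -> h`_3 = 1 ->
  defect I x 2 = 1%N /\ forall k, (3 <= k)%N -> defect I x k = 0%N.
Proof.
move=> h4 h3; split=> [|k k3].
  have := hilbert_sum_defect 2; rewrite h4 [RHS]big_ord_recr /= h3.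
  by move/addrI => [].
have := hilbert_sum_defect k; rewrite sum_coef_ge; last by rewrite h4.
by move/eqP; rewrite -subr_eq0 addrAC subrr add0r => /eqP[].
Qed.

End HilbertReduction.

Lemma reduction_reduces (A : comNzRingType) (I : set A) (x : A) :
  reduction I (gen_ideal [set x]) ->
  I x /\ exists n0, forall n, (n0 <= n)%N -> reduces I [:: x] n.
Proof.
move=> [_ xI [n0 E]]; split; first by apply: xI; apply: mem_gen_ideal.
exists n0 => n n0n; apply: reduces_le n0n _.
have xE : [set` [:: x]] = [set x].
  by apply/seteqP; split=> u /=; rewrite inE => /eqP.
by rewrite /reduces xE E.
Qed.

Theorem proposition4p1 (A : comNzRingType) (m I : idealr A) (d : nat)
    (h : {poly int}) :
  local_ring [set` m] ->
  cohen_macaulay A ->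
  krull_dim A d ->
  (d <= 1)%N ->
  infinite_set [set: {ideal_quot m}] ->
  primary_to [set` m] [set` I] ->
  integrally_closed [set` I] ->
  h_polynomial [set` I] d h ->
  hilbert_coef h 2 = hilbert_coef h 1 - hilbert_coef h 0
                     + (quotient_length setT [set` I])%:Z + 1 ->
  size h = 4%N /\
  (d = 1%N -> forall x : A,
     minimal_reduction [set` I] (gen_ideal [set x]) ->
     ~ (ideal_exp [set` I] 3 `<=` gen_ideal [set x]) ->
     cohen_macaulay (assoc_graded I)).

Proof.
move=> mloc cm dimA d1 infk primI icI hI rel; have [noethA _] := cm.
have iI := idealr_ideal I.
have h0 := h_polynomial_neq0 hI.
have sum1 : \sum_(n < (size h).-1) h`_n.+1 *+ 'C(n, 2) = 1.
  apply: hilbert_coef_relation rel => //; rewrite (h_polynomial_coef0 hI).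
  by rewrite /hilbert_fun ideal_exp1.
case: d d1 dimA hI => [|[|//]] _ dimA hI.
  have [|h4 _] := size4_nonneg h0 _ sum1; last by split.
  by move=> n; rewrite (h_polynomial_dim0 n hI).
have [y [my y_reg]] := cm_dim1_regular mloc cm dimA.
have [e H_le] := hilbert_fun_bounded hI.
have [h4 h3] : size h = 4%N /\ h`_3 = 1.
  (* For the degree, some principal reduction is produced from the infinite residue field; claim
     (ii) works with the given x. *)
  have [c c_indep] := infinite_residue_field infk.
  have [|x [n0 [Ix red]]] := exists_principal_reduction mloc noethA primI c_indep (e := e).
    by move=> n; rewrite -hilbert_funE.
  by apply: size4_partial_sums => // k; apply: (partial_sums_le mloc noethA primI Ix my y_reg red).
split=> // _ x [/reduction_reduces[Ix [n0 red]] _] nI3.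
have [d2 d3] := defect_size4 mloc noethA primI Ix my y_reg red hI h4 h3.
apply: (assoc_graded_cohen_macaulay Ix (e := e)) => [k a|n].
  exact: (scale_exp_regular mloc noethA primI Ix my y_reg red).
apply: lenleW (H_le n) _; rewrite hilbert_funE.
apply: lenle_mlen; [exact: ideal_expP|exact: ideal_expS_sub|].
exact: (flen_sub_exp mloc noethA primI _ (fun z Iz => Iz)).
Qed.
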